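(* Let $V,W$ be inner product $\mathscr{A}$-modules over a $C^*$-algebra $\mathscr{A}$, let $\varepsilon\in[0,\frac12)$ and let $T:V\to W$ be a linear mapping satisfying $x\perp_B y\Longrightarrow Tx\perp^s_{B^\varepsilon}Ty$ for all $x,y\in V$. Then $$(1-16\varepsilon)\,\|T\|\,\|x\|\le\|Tx\|\le\|T\|\,\|x\|\qquad\text{for all }x\in V.$$
   Context: An inner product $\mathscr{A}$-module is a right $\mathscr{A}$-module with an $\mathscr{A}$-valued inner product $\langle\cdot,\cdot\rangle$ (conjugate-linear in the first variable, $\mathscr{A}$-linear in the second), normed by $\|x\|=\|\langle x,x\rangle\|^{1/2}$ (not necessarily complete). $\|T\|=\sup\{\|Tx\|:\|x\|\le1\}$ is the operator norm. Birkhoff--James orthogonality: $x\perp_B y$ means $\|x+\lambda y\|\ge\|x\|$ for all $\lambda\in\mathbb{C}$. Approximate strong Birkhoff--James orthogonality: $u\perp^s_{B^\varepsilon}v$ means $\|u+va\|^2\ge\|u\|^2-2\varepsilon\|a\|\|u\|\|v\|$ for all $a\in\mathscr{A}$. *)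

(* Defs.v *)
From HB Require Import structures.
From mathcomp Require Import all_boot all_order all_algebra.
From mathcomp.real_closed Require Export complex.
From mathcomp Require Import all_classical all_reals all_analysis.
Import Order.TTheory GRing.Theory Num.Theory.
Import numFieldNormedType.Exports.

Set Implicit Arguments.
Unset Strict Implicit.
Unset Printing Implicit Defensive.

Local Open Scope classical_set_scope.
Local Open Scope ring_scope.
Local Open Scope complex_scope.

(* C*-algebras are not assumed unital, so the product is not a ring structure
   of MathComp (whose rings all have a unit). *)
HB.mixin Record isCStarAlgebra (R : realType) A
    of CompleteNormedModule R[i] A := {
  cs_mul : A -> A -> A ;
  cs_star : A -> A ;
  cs_mulA : forall a b c, cs_mul a (cs_mul b c) = cs_mul (cs_mul a b) c ;
  cs_mulDl : forall a b c, cs_mul (a + b) c = cs_mul a c + cs_mul b c ;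
  cs_mulDr : forall a b c, cs_mul a (b + c) = cs_mul a b + cs_mul a c ;
  cs_scalerAl : forall (k : R[i]) a b, cs_mul (k *: a) b = k *: cs_mul a b ;
  cs_scalerAr : forall (k : R[i]) a b, cs_mul a (k *: b) = k *: cs_mul a b ;
  cs_starD : forall a b, cs_star (a + b) = cs_star a + cs_star b ;
  cs_starZ : forall (k : R[i]) a, cs_star (k *: a) = conjc k *: cs_star a ;
  cs_starM : forall a b, cs_star (cs_mul a b) = cs_mul (cs_star b) (cs_star a) ;
  cs_starK : forall a, cs_star (cs_star a) = a ;
  cs_normM : forall a b, `|cs_mul a b| <= `|a| * `|b| ;
  cs_normC : forall a, `|cs_mul (cs_star a) a| = `|a| ^+ 2
}.

#[short(type="cstarAlgType")]
HB.structure Definition CStarAlgebra (R : realType) :=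
  {A of isCStarAlgebra R A & CompleteNormedModule R[i] A}.

Definition cs_pos (R : realType) (A : cstarAlgType R) (a : A) : Prop :=
  exists b : A, a = cs_mul (cs_star b) b.

(* Over the field R[i] the library norm takes its (nonnegative real) values in
   R[i]; this is the same norm with values in R. *)
Definition cs_norm (R : realType) (A : cstarAlgType R) (a : A) : R :=
  complex.Re `|a|.

HB.mixin Record isInnerProductModule (R : realType) (A : cstarAlgType R) V
    of GRing.Lmodule R[i] V := {
  im_act : V -> A -> V ;
  im_inner : V -> V -> A ;
  im_actM : forall x a b, im_act x (cs_mul a b) = im_act (im_act x a) b ;
  im_actDl : forall x y a, im_act (x + y) a = im_act x a + im_act y a ;
  im_actDr : forall x a b, im_act x (a + b) = im_act x a + im_act x b ;
  im_actZl : forall (k : R[i]) x a, im_act (k *: x) a = k *: im_act x a ;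
  im_actZr : forall (k : R[i]) x a, im_act x (k *: a) = k *: im_act x a ;
  im_innerDr : forall x y z, im_inner x (y + z) = im_inner x y + im_inner x z ;
  im_innerZr : forall (k : R[i]) x y, im_inner x (k *: y) = k *: im_inner x y ;
  im_innerAr : forall x y a, im_inner x (im_act y a) = cs_mul (im_inner x y) a ;
  im_inner_star : forall x y, cs_star (im_inner x y) = im_inner y x ;
  im_inner_pos : forall x, cs_pos (im_inner x x) ;
  im_inner_eq0 : forall x, im_inner x x = 0 -> x = 0
}.

#[short(type="innerModType")]
HB.structure Definition InnerProductModule (R : realType)
    (A : cstarAlgType R) :=
  {V of isInnerProductModule R A V & GRing.Lmodule R[i] V}.

Definition im_norm (R : realType) (A : cstarAlgType R) (V : innerModType A)
    (x : V) : R :=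
  Num.sqrt (cs_norm (im_inner x x)).

Definition bj_orth (R : realType) (A : cstarAlgType R) (V : innerModType A)
    (x y : V) : Prop :=
  forall k : R[i], im_norm (x + k *: y) >= im_norm x.

Definition approx_strong_bj_orth (R : realType) (A : cstarAlgType R)
    (V : innerModType A) (eps : R) (u v : V) : Prop :=
  forall a : A,
    im_norm (u + im_act v a) ^+ 2 >=
    im_norm u ^+ 2 - 2 * eps * cs_norm a * im_norm u * im_norm v.

(* The supremum is taken in \bar R: it is +oo exactly when T is unbounded. *)
Definition op_norm (R : realType) (A : cstarAlgType R) (V W : innerModType A)
    (T : V -> W) : \bar R :=
  ereal_sup [set (im_norm (T x))%:E | x in [set x : V | im_norm x <= 1]].

(* Main.v *)
Require Import Defs.
From mathcomp Require Import all_boot all_order all_algebra.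
From mathcomp Require Import all_classical all_reals all_analysis.
From mathcomp Require Import ring lra.
From HB Require Import structures.
Import Order.TTheory GRing.Theory Num.Theory.
Import numFieldNormedType.Exports.

Set Implicit Arguments.
Unset Strict Implicit.
Unset Printing Implicit Defensive.

Local Open Scope ring_scope.
Local Open Scope complex_scope.

(** The statement follows from one inequality: for unit vectors [x], [y] of
    [V], [(1 - 16 eps) |T y| <= |T x|] ([orth_preserver_norm_ge]); it bounds
    [T] as soon as [16 eps < 1], and gives the lower bound by taking the
    supremum over [y].

    First, strong orthogonality is weakened to
    [|u + k v|^2 >= |u|^2 - 2 eps |k| |u| |v|] for complex [k]
    ([approx_bj_of_strong]). This needs [a] in the unit ball of the algebra with
    [v a] close to [v] ([approximate_unit]): for selfadjoint [h = <v, v>] one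
    takes [- y], where [1 + y] is the inverse of [1 - i t h]. The unitarity of
    the Cayley transform [1 + 2 y] gives [2 y^* y = - (y + y^* )], whence
    [|y| <= 1].

    Next, consider the quotient [|T z| / |z|] on the segment [z_t] from [x] to
    [y], where the sign of [x] is chosen so that [|z_t| >= 1/2]
    ([segment_norm_ge]). At each point [z_t] a norming functional gives a scalar
    [m_t] with [w - m_t z_t] orthogonal to [z_t], where [w = y - x]
    ([exists_bj_orth]). Hence both [log |z_t|] and [log |T z_t|] have [Re m_t]
    as a slope, the second up to an error of
    [2 eps |T (w - m_t z_t)| / |T z_t|]. No differentiability is needed: along a
    subdivision of step [h] the factors [1 + h Re m] at the left end and
    [1 - h Re m'] at the right end of each step telescope up to [O(h^2)]
    ([segment_step]). If [M] is the norm of [T] on the span of [x] and [y], the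
    total error is at most [16 eps M] ([segment_lower]); the inequality follows
    by choosing [y] almost maximal in that span.

    All of this uses the Cauchy-Schwarz and triangle inequalities in an inner
    product module ([im_inner_cauchy_schwarz], [im_normD]), hence the positivity
    of elements [c^* c], which is obtained here without spectral theory or a
    unit ([star_sqr_accretive]). Positivity of [h] is expressed by accretivity:
    [|b| <= |b + t h b|] for all [t >= 0] and all [b]. It is closed under sums
    ([accretiveD]). The link with norms is [selfadj_norm_le]: the norm of a
    selfadjoint operator [D] is at most [B] when [l - D] and [l + D] are bounded
    below for all [l > B]. That [c^* c] is accretive follows Kaplansky's
    argument: with [f = (c^* c + nu + i eta)^-1] and [d = c f], the element
    [d^* d = c^* c |f|^2] is bounded above by [1 / (4 nu)], and then so is
    [d d^*], while [d^* d + d d^*] is positive. So [|d^* d| <= 1 / (4 nu)],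
    which bounds [f] independently of [eta] ([resolvent_bound]). Resolvents
    exist by continuation along a segment ([quasi_inverse]). *)

(** * Equalities in modules *)

(** Linear expressions with scalars in [K]; [LVar n] is the [n]-th atom. The
    tactic [lmod] below reduces an equality in a module over the complex numbers
    to one scalar equality for each atom. *)
Inductive lexpr (K : Type) : Type :=
  | LVar of nat | LZero | LAdd of lexpr K & lexpr K
  | LOpp of lexpr K | LScale of K & lexpr K.
Arguments LVar {K}.
Arguments LZero {K}.

Section Lexpr.
Variables (K : comNzRingType) (M : lmodType K).

Fixpoint leval (env : seq M) (e : lexpr K) : M :=
  match e with
  | LVar n => nth 0 env n
  | LZero => 0
  | LAdd e1 e2 => leval env e1 + leval env e2
  | LOpp e1 => - leval env e1
  | LScale k e1 => k *: leval env e1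
  end.

(** The coefficient of the [i]-th atom. *)
Fixpoint lcoef (e : lexpr K) (i : nat) : K :=
  match e with
  | LVar n => if n == i then 1 else 0
  | LZero => 0
  | LAdd e1 e2 => lcoef e1 i + lcoef e2 i
  | LOpp e1 => - lcoef e1 i
  | LScale k e1 => k * lcoef e1 i
  end.

Lemma levalE env e :
  leval env e = \sum_(i < size env) lcoef e i *: nth 0 env i.
Proof.
elim: e => /= [n||e1 -> e2 ->|e1 ->|k e1 ->].
- have [lt_n|ge_n] := ltnP n (size env).
    rewrite (bigD1 (Ordinal lt_n)) //= eqxx scale1r big1 ?addr0 // => i ne_i.
    case: eqP => [eq_i|_]; last by rewrite scale0r.
    by case/eqP: ne_i; apply: val_inj.
  rewrite nth_default // big1 // => i _; case: eqP => [eq_i|_]; last by rewrite scale0r.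
  by have := ltn_ord i; rewrite -eq_i ltnNge ge_n.
- by rewrite big1 // => i _; rewrite scale0r.
- by rewrite -big_split; apply: eq_bigr => i _; rewrite scalerDl.
- by rewrite -sumrN; apply: eq_bigr => i _; rewrite scaleNr.
- by rewrite scaler_sumr; apply: eq_bigr => i _; rewrite scalerA.
Qed.

(** Conjunction of [P i] for [i < n]. *)
Fixpoint lall (n : nat) (P : nat -> Prop) : Prop :=
  if n is n'.+1 then lall n' P /\ P n' else True.

Lemma lexpr_correct env e1 e2 :
  lall (size env) (fun i => lcoef e1 i = lcoef e2 i) ->
  leval env e1 = leval env e2.
Proof.
move=> eq12; rewrite !levalE; apply: eq_bigr => -[i lt_i] _ /=; congr (_ *: _).
elim: (size env) eq12 lt_i => // n IHn [eq_n eq_at] ; rewrite ltnS leq_eqVlt.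
by case/orP => [/eqP->|/(IHn eq_n)].
Qed.
End Lexpr.

Ltac lidx x env :=
  match env with
  | x :: _ => constr:(O)
  | _ :: ?env' => let n := lidx x env' in constr:(S n)
  end.
Ltac ladd x env :=
  match env with
  | context [cons x _] => env
  | _ => constr:(cons x env)
  end.
Ltac latoms e env :=
  lazymatch e with
  | @GRing.add _ ?a ?b => let env1 := latoms a env in latoms b env1
  | @GRing.opp _ ?a => latoms a env
  | @GRing.scale _ _ ?k ?a => latoms a env
  | @GRing.zero _ => env
  | _ => ladd e env
  end.
Ltac lreify K e env :=
  lazymatch e with
  | @GRing.add _ ?a ?b =>
    let a' := lreify K a env in let b' := lreify K b env in
    constr:(@LAdd K a' b')
  | @GRing.opp _ ?a => let a' := lreify K a env in constr:(@LOpp K a')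
  | @GRing.scale _ _ ?k ?a => let a' := lreify K a env in constr:(@LScale K k a')
  | @GRing.zero _ => constr:(@LZero K)
  | _ => let n := lidx e env in constr:(@LVar K n)
  end.
Ltac lmod :=
  lazymatch goal with
  | |- @eq ?T ?a ?b =>
    let R := match goal with R : realType |- _ => constr:(R) end in
    let K := constr:((R[i])%type : comNzRingType) in
    let M := constr:(T : lmodType R[i]) in
    let env0 := latoms a (@nil T) in let env := latoms b env0 in
    let a' := lreify K a env in let b' := lreify K b env in
    change (@leval K M env a' = @leval K M env b');
    apply: lexpr_correct; rewrite /=; repeat split
  end.


Local Notation "a ** b" := (cs_mul a b) (at level 40, left associativity).
Local Notation "a ^#" := (cs_star a) (at level 2, format "a ^#").
Local Notation nm := cs_norm.

(** * Complex scalars *)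

Section Scalars.
Variable R : realType.

(** The modulus with values in [R] rather than [R[i]]. *)
Definition cabs (z : R[i]) : R := complex.Re `|z|.

Lemma normC_cabs z : `|z| = (cabs z)%:C.
Proof. by rewrite /cabs normc_def. Qed.

Lemma cabs_ge0 z : 0 <= cabs z.
Proof. by rewrite /cabs normc_def /= sqrtr_ge0. Qed.

Lemma cabs0 : cabs 0 = 0. Proof. by rewrite /cabs normr0. Qed.

Lemma cabs_eq0 z : (cabs z == 0) = (z == 0).
Proof. by rewrite -[z == 0]normr_eq0 normC_cabs (inj_eq (@complexI _)). Qed.

Lemma cabs_gt0 z : (0 < cabs z) = (z != 0).
Proof. by rewrite lt0r cabs_ge0 andbT cabs_eq0. Qed.

Lemma cabs_real (x : R) : cabs x%:C = `|x|.
Proof. by rewrite /cabs normc_def /= expr0n addr0 sqrtr_sqr. Qed.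

Lemma cabsM z w : cabs (z * w) = cabs z * cabs w.
Proof. by apply: complexI; rewrite rmorphM -!normC_cabs normrM. Qed.

Lemma cabsV z : cabs z^-1 = (cabs z)^-1.
Proof. by apply: complexI; rewrite -normC_cabs normfV normC_cabs fmorphV. Qed.

Lemma cabsJ z : cabs (conjc z) = cabs z.
Proof. by rewrite /cabs normcJ. Qed.

Lemma cabsN z : cabs (- z) = cabs z.
Proof. by rewrite /cabs normrN. Qed.

Lemma cabs1 : cabs 1 = 1. Proof. by rewrite /cabs normr1. Qed.

Lemma cabsi : cabs 'i = 1.
Proof. by rewrite /cabs normc_def /= expr0n add0r expr1n sqrtr1. Qed.

Lemma cabs_sqr z : cabs z ^+ 2 = complex.Re z ^+ 2 + complex.Im z ^+ 2.
Proof. by rewrite /cabs normc_def /= sqr_sqrtr // addr_ge0 // sqr_ge0. Qed.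

Lemma Re_le_cabs z : `|complex.Re z| <= cabs z.
Proof. by have := normc_ge_Re z; rewrite normC_cabs lecR. Qed.

End Scalars.

(** * Norm and involution of a C*-algebra *)

Section CStar.
Variables (R : realType) (A : cstarAlgType R).
Implicit Types (a b c x y : A) (k : R[i]).

Lemma norm_nm a : `|a| = (nm a)%:C.
Proof.
have := normr_ge0 a; rewrite lecE /= => /andP[/eqP im0 _]; rewrite /cs_norm.
by case: `|a| im0 => /= r i ->.
Qed.

Lemma nm_ge0 a : 0 <= nm a.
Proof. by have := normr_ge0 a; rewrite norm_nm lecR. Qed.

Lemma nm0 : nm (0 : A) = 0. Proof. by rewrite /cs_norm normr0. Qed.

Lemma nm_eq0 a : nm a = 0 -> a = 0.
Proof. by move=> na; apply/eqP; rewrite -normr_eq0 norm_nm na. Qed.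

Lemma nmD a b : nm (a + b) <= nm a + nm b.
Proof. by have := ler_normD a b; rewrite !norm_nm -rmorphD lecR. Qed.

Lemma nmN a : nm (- a) = nm a. Proof. by rewrite /cs_norm normrN. Qed.

Lemma nmB a b : nm (a - b) <= nm a + nm b.
Proof. by rewrite -(nmN b) nmD. Qed.

Lemma nmZ k a : nm (k *: a) = cabs k * nm a.
Proof. by have := normrZ k a; rewrite !norm_nm normC_cabs -rmorphM => /complexI. Qed.

Lemma nmM a b : nm (a ** b) <= nm a * nm b.
Proof. by have := cs_normM a b; rewrite !norm_nm -rmorphM lecR. Qed.

Lemma nmC a : nm (a^# ** a) = nm a ^+ 2.
Proof. by have := cs_normC a; rewrite !norm_nm -rmorphXn => /complexI. Qed.

Lemma cs_mul0r a : 0 ** a = 0.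
Proof. by apply: (addIr (0 ** a)); rewrite -cs_mulDl !add0r. Qed.

Lemma cs_mulr0 a : a ** 0 = 0.
Proof. by apply: (addIr (a ** 0)); rewrite -cs_mulDr !add0r. Qed.

Lemma cs_mulNr a b : (- a) ** b = - (a ** b).
Proof. by rewrite -scaleN1r cs_scalerAl scaleN1r. Qed.

Lemma cs_mulrN a b : a ** (- b) = - (a ** b).
Proof. by rewrite -scaleN1r cs_scalerAr scaleN1r. Qed.

Lemma cs_starN a : (- a)^# = - a^#.
Proof. by rewrite -scaleN1r cs_starZ rmorphN rmorph1 scaleN1r. Qed.

Lemma cs_star0 : (0 : A)^# = 0.
Proof. by rewrite -{1}(scale0r (0 : A)) cs_starZ rmorph0 scale0r. Qed.

(** Expansion of products over sums and scalar multiples. *)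
Definition csE := (@cs_mulDl _ A, @cs_mulDr _ A, cs_mulNr, cs_mulrN,
  @cs_scalerAl _ A, @cs_scalerAr _ A, cs_mul0r, cs_mulr0, @cs_starD _ A,
  cs_starN, @cs_starZ _ A, cs_star0, @cs_starM _ A, @cs_starK _ A).

Lemma nm_star a : nm a^# = nm a.
Proof.
have le b : nm b <= nm b^#.
  have [nb0|nz] := eqVneq (nm b) 0; first by rewrite nb0 nm_ge0.
  have b_gt0 : 0 < nm b by rewrite lt0r nz nm_ge0.
  by rewrite -(ler_pM2r b_gt0) -expr2 -nmC nmM.
by apply/eqP; rewrite eq_le le andbT -{2}(cs_starK a) le.
Qed.

Lemma nm_sub a b : nm a <= nm (a + b) + nm b.
Proof. by rewrite -{1}(addrK b a) nmB. Qed.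

(** When [X^* Y] is selfadjoint, [X^* X + Y^* Y] is both [(X + iY)^* (X + iY)]
    and [(X - iY)^* (X - iY)]. *)
Lemma nm_sum_squares (X Y : A) : X^# ** Y = Y^# ** X ->
  nm X ^+ 2 <= nm (X^# ** X + Y^# ** Y) /\ nm Y ^+ 2 <= nm (X^# ** X + Y^# ** Y).
Proof.
move=> XY; set S := _ + _.
have nP (e : R[i]) : e * e = -1 -> conjc e = - e -> nm (X + e *: Y) ^+ 2 = nm S.
  by move=> ee eJ; rewrite -nmC /S !csE eJ XY; congr (cs_norm _); lmod; ring: ee.
have ii : 'i * 'i = -1 :> R[i] by rewrite -expr2 sqr_i.
have Ji : conjc 'i = - 'i :> R[i] by apply/eqP; rewrite eq_complex /= oppr0 !eqxx.
have np := nP 'i ii Ji.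
have nii : - 'i * - 'i = -1 :> R[i] by rewrite mulrNN.
have Jni : conjc (- 'i) = - - 'i :> R[i] by apply/eqP; rewrite eq_complex /= !oppr0 !eqxx.
have nn := nP (- 'i) nii Jni.
have eq_pn : nm (X + - 'i *: Y) = nm (X + 'i *: Y).
  by apply/eqP; rewrite -(@eqrXn2 _ 2) ?nm_ge0 // nn np.
have half : cabs (2^-1 : R[i]) = 2^-1.
  by rewrite cabsV -(rmorph_nat (real_complex R)) cabs_real normr_nat.
split; rewrite -np ler_pXn2r ?nnegrE ?nm_ge0 //.
- have {1}-> : X = 2^-1 *: ((X + 'i *: Y) + (X + - 'i *: Y)).
    by lmod; field.
  rewrite nmZ half (le_trans (ler_wpM2l _ (nmD _ _))) ?invr_ge0 //.
  by rewrite eq_pn; lra.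
- have {1}-> : Y = (2^-1 * - 'i) *: ((X + 'i *: Y) - (X + - 'i *: Y)).
    by lmod; field: ii.
  rewrite nmZ cabsM half cabsN cabsi (le_trans (ler_wpM2l _ (nmB _ _))) ?mulr1 ?invr_ge0 //.
  by rewrite eq_pn; lra.
Qed.
End CStar.

(** * Selfadjoint operators on a C*-algebra *)

Section Operators.
Variables (R : realType) (A : cstarAlgType R).
Implicit Types (a b c : A) (p q D : {linear A -> A}) (k : R[i]).

Lemma nmZr (r : R) a : 0 <= r -> nm (r%:C *: a) = r * nm a.
Proof. by move=> r0; rewrite nmZ cabs_real ger0_norm. Qed.

(** A map [p] with [<p a, b> = <a, p b>] for the inner product [a^* b] on the
    algebra. Operators rather than elements are used, so that real scalars can
    be added in an algebra without unit. *)
Definition selfadj (p : A -> A) := forall a b, (p a)^# ** b = a^# ** p b.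

Lemma selfadj_comp p : selfadj p -> selfadj (p \o p).
Proof. by move=> sp a b; rewrite /= !sp. Qed.

Lemma selfadj_nm p b : selfadj p -> nm (p b) ^+ 2 <= nm b * nm (p (p b)).
Proof. by move=> sp; rewrite -nmC sp (le_trans (nmM _ _)) // nm_star. Qed.

(** The inequalities [2 |s x| <= 1 + s^2 x^2] and [|1 - s^2 x^2| <= 1 + s^2 x^2]
    on a selfadjoint operator, from
    [(2 s p)^2 + (1 - s^2 p^2)^2 = (1 + s^2 p^2)^2]. *)
Lemma selfadj_sqr_bounds p (s : R) b : selfadj p -> 0 <= s ->
  2 * s * nm (p b) <= nm (b + (s ^+ 2)%:C *: p (p b)) /\
  nm (b - (s ^+ 2)%:C *: p (p b)) <= nm (b + (s ^+ 2)%:C *: p (p b)).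
Proof.
move=> sp s0; set Z := b + _; set Y := b - _.
pose X := (2 * s)%:C *: p b.
have XY : X^# ** Y = Y^# ** X.
  by rewrite /X /Y !csE ?conjc_real !sp; lmod; ring.
have XYZ : X^# ** X + Y^# ** Y = Z^# ** Z.
  rewrite /X /Y /Z !csE ?conjc_real !sp.
  by lmod; rewrite ?rmorphM ?rmorphXn ?rmorph_nat; ring.
have := nm_sum_squares XY; rewrite XYZ nmC !ler_pXn2r ?nnegrE ?nm_ge0 //.
by rewrite nmZr // mulr_ge0.
Qed.

Lemma selfadj_sqr_accretive p (t : R) b : selfadj p -> 0 <= t ->
  nm b <= nm (b + t%:C *: p (p b)).
Proof.
move=> sp t0; have [_] := selfadj_sqr_bounds b sp (sqrtr_ge0 t).
rewrite sqr_sqrtr //; set Y := b - _; set Z := b + _ => YZ.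
have -> : b = (2^-1)%:C *: (Z + Y) by rewrite /Z /Y; lmod; rewrite ?rmorphV ?rmorph_nat ?unitfE//; field.
rewrite nmZr ?invr_ge0 //; have := nmD Z Y; lra.
Qed.

(** If [1 - D^2] is bounded below, a selfadjoint contraction [D] is a strict
    contraction: [|D x| <= kappa |(1 - D^2) x|] improves to
    [|D^2 x| <= kappa/2 |(1 - D^4) x|], and so on through the powers
    [D^(2^n)]. *)
Lemma strict_contraction n D (kap : R) : selfadj D ->
  (forall b, nm (D b) <= nm b) -> kap <= 2 ^+ n / 4 -> 0 <= kap ->
  (forall b, nm (D b) <= kap * nm (b - D (D b))) ->
  exists th : R, [/\ 0 <= th, th < 1 & forall b, nm (D b) <= th * nm b].
Proof.
elim: n D kap => [|n IHn] D kap sD D1 kap_le kap0 lowD.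
  exists 2^-1; split; [by rewrite invr_ge0| by lra|] => b.
  have := lowD b; have := nmB b (D (D b)); have := D1 (D b); have := D1 b.
  have := nm_ge0 b; rewrite expr0 in kap_le => b0 h1 h2 h3 h4.
  apply: (le_trans h4); apply: (@le_trans _ _ (kap * (2 * nm b))).
    by apply: ler_wpM2l => //; lra.
  by rewrite mulrA ler_wpM2r //; lra.
have [|b|||b|th [th0 th1 thD]] := IHn (D \o D) (kap / 2).
- exact: selfadj_comp.
- by rewrite /= (le_trans (D1 _)).
- by move: kap_le; rewrite exprS; lra.
- by rewrite divr_ge0.
- have DD (x y : A) : D (x + y) = D x + D y by exact: linearD.
  have := lowD (b + D (D b)); rewrite !DD opprD addrACA addrA subrK.
  have := selfadj_sqr_bounds (D b) sD ler01; rewrite expr1n scale1r => -[h _] h'.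
  by have := le_trans h h'; rewrite /=; lra.
exists (Num.sqrt th); split; first exact: sqrtr_ge0.
  by rewrite -sqrtr1 ltr_sqrt.
move=> b; rewrite -(@ler_pXn2r _ 2) ?nnegrE ?mulr_ge0 ?sqrtr_ge0 ?nm_ge0 //.
rewrite exprMn sqr_sqrtr // (le_trans (selfadj_nm b sD)) //.
by rewrite expr2 mulrCA ler_wpM2l ?nm_ge0 // thD.
Qed.
End Operators.

(** * Norm bounds and accretive operators *)

Section Accretive.
Variables (R : realType) (A : cstarAlgType R).
Implicit Types (a b c : A) (p q D : {linear A -> A}) (k : R[i]).

Lemma le_mul_eps (x y z : R) : 0 <= z ->
  (forall e, 0 < e -> x <= y + e * z) -> x <= y.
Proof.
move=> z0 xy; apply/ler_addgt0Pr => e e0.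
have z1 : 0 < z + 1 by rewrite ltr_wpDl.
apply: (le_trans (xy (e / (z + 1)) _)); first by rewrite divr_gt0.
by rewrite lerD2l mulrAC ler_pdivrMr // ler_pM2l // lerDl.
Qed.

(** Boundedness on the algebra. *)
Definition bounded (p : A -> A) :=
  exists2 C : R, 0 <= C & forall b, nm (p b) <= C * nm b.

(** The absence of approximate kernel: [0] is not an approximate eigenvalue. *)
Definition bounded_below (p : A -> A) :=
  exists2 C : R, 0 <= C & forall b, nm b <= C * nm (p b).

(** For a selfadjoint operator, bounded-belowness of [l - D] and [l + D] for
    all real [l > B] means that no approximate eigenvalue has modulus more than
    [B]; the norm is then at most [B]. *)
Lemma selfadj_norm_le D (B : R) : selfadj D -> bounded D -> 0 <= B ->
  (forall l : R, B < l -> bounded_below (fun b => l%:C *: b - D b)) ->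
  (forall l : R, B < l -> bounded_below (fun b => l%:C *: b + D b)) ->
  forall b, nm (D b) <= B * nm b.
Proof.
move=> sD [C C0 DC] B0 lowB lowD.
pose S : set R := [set n | 0 <= n /\ forall b, nm (D b) <= n * nm b]%classic.
have S_low : lbound S 0 by move=> n [].
have S0 : (S !=set0)%classic by exists C.
have hasS : has_inf S by split => //; exists 0.
(* [N] is the operator norm of [D]; if it exceeds [B], then [D / N] is a strict
   contraction, which contradicts its minimality. *)
set N := inf S.
have N0 : 0 <= N by apply: lb_le_inf.
have ND b : nm (D b) <= N * nm b.
  have [b0|b_n0] := eqVneq (nm b) 0.
    by have := DC b; rewrite b0 !mulr0.
  have b_gt0 : 0 < nm b by rewrite lt0r b_n0 nm_ge0.
  rewrite -ler_pdivrMr //; apply: lb_le_inf => // n [n0 nD].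
  by rewrite ler_pdivrMr.
have [NB b|ltBN] := leP N B.
  by rewrite (le_trans (ND b)) // ler_wpM2r ?nm_ge0.
have N_gt0 : 0 < N by exact: le_lt_trans ltBN.
have N_n0 : N%:C != 0 by rewrite -(rmorph0 (real_complex R)) (inj_eq (@complexI _)) gt_eqF.
pose D' : {linear A -> A} := (N^-1)%:C \*: D.
have D'E b : D' b = (N^-1)%:C *: D b by [].
have [C1 C10 lo1] := lowB N ltBN; have [C2 C20 lo2] := lowD N ltBN.
set kap := C2 * C1 * N ^+ 2.
have kap0 : 0 <= kap by rewrite !mulr_ge0 // exprn_ge0.
have D'1 b : nm (D' b) <= nm b.
  by rewrite D'E nmZr ?invr_ge0 // mulrC ler_pdivrMr // mulrC.
have [|||th [th0 th1 thD]] :=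
  @strict_contraction _ _ (Num.Def.archi_bound (kap * 4)) D' kap _ D'1 _ kap0.
- by move=> a b; rewrite !D'E !csE conjc_real sD.
- rewrite ler_pdivlMr // (le_trans (ltW (archi_boundP _))) ?mulr_ge0 //.
  by rewrite -natrX ler_nat ltnW // ltn_expl.
- move=> b; apply: (le_trans (D'1 b)); apply: (le_trans (lo2 b)).
  rewrite /kap -!(mulrA C2) -(mulrA C1) ler_wpM2l //; apply: (le_trans (lo1 _)).
  rewrite ler_wpM2l // -(@nmZr _ _ (N ^+ 2)) ?exprn_ge0 // !D'E.
  have DD x y : D (x + y) = D x + D y by exact: linearD.
  have DZ k x : D (k *: x) = k *: D x by exact: linearZ.
  rewrite DD !DZ.
  rewrite le_eqVlt; apply/orP; left; apply/eqP; congr (cs_norm _).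
  lmod; rewrite ?rmorphXn ?fmorphV; by field.
have : S (N * th).
  split=> [|b]; first exact: mulr_ge0.
  by have := thD b; rewrite D'E nmZr ?invr_ge0 // ler_pdivrMl // mulrA.
move=> /(ge_inf (proj2 hasS)); rewrite -/N => le_th.
have : N * th < N * 1 by rewrite ltr_pM2l.
by rewrite mulr1 ltNge le_th.
Qed.

(** The norm form of positivity of an operator. *)
Definition accretive (p : A -> A) :=
  forall (t : R) b, 0 <= t -> nm b <= nm (b + t%:C *: p b).

(** Accretivity at [b - t p b] gives [|b - t p b| <= |b - t^2 p^2 b|]. *)
Lemma accretive_step p (C t : R) b : accretive p ->
  (forall b, nm (p b) <= C * nm b) -> 0 <= C -> 0 <= t ->
  nm (b - t%:C *: p b) <= (1 + t ^+ 2 * C ^+ 2) * nm b.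
Proof.
move=> acc_p pC C0 t0; apply: (le_trans (acc_p t _ t0)).
have -> : b - t%:C *: p b + t%:C *: p (b - t%:C *: p b) = b - (t ^+ 2)%:C *: p (p b).
  have pB x y : p (x - y) = p x - p y by exact: linearB.
  have pZ k x : p (k *: x) = k *: p x by exact: linearZ.
  by rewrite pB pZ; lmod; ring.
rewrite (le_trans (nmB _ _)) // mulrDl mul1r lerD2l nmZr ?exprn_ge0 // -mulrA.
rewrite ler_wpM2l ?exprn_ge0 // (le_trans (pC _)) // expr2 -mulrA.
by rewrite ler_wpM2l.
Qed.

(** To first order in [e], [1 - e (p + q)] is the mean of the contractions
    [1 - 2 e p] and [1 - 2 e q]. *)
Lemma accretiveD p q : accretive p -> accretive q -> bounded p -> bounded q ->
  accretive (fun b => p b + q b).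
Proof.
move=> acc_p acc_q [C C0 pC] [C' C'0 qC'] s b s0.
pose K := 2 * (C ^+ 2 + C' ^+ 2).
have K0 : 0 <= K by rewrite mulr_ge0 // addr_ge0 ?exprn_ge0.
have step e : 0 <= e -> nm (b - e%:C *: (p b + q b)) <= (1 + e ^+ 2 * K) * nm b.
  move=> e0; have e20 : 0 <= 2 * e by rewrite mulr_ge0.
  have -> : b - e%:C *: (p b + q b) = (2^-1)%:C *:
      ((b - (2 * e)%:C *: p b) + (b - (2 * e)%:C *: q b)).
    by lmod; rewrite ?rmorphM ?fmorphV ?rmorph_nat; field.
  rewrite nmZr ?invr_ge0 //.
  have := nmD (b - (2 * e)%:C *: p b) (b - (2 * e)%:C *: q b).
  have := accretive_step b acc_p pC C0 e20.
  have := accretive_step b acc_q qC' C'0 e20.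
  by rewrite /K; lra.
(* The vector [(1 + s / e) b] is [b + s (p + q) b] plus [s / e] times
   [b - e (p + q) b]. *)
apply: (@le_mul_eps _ _ (s * K * nm b)); first exact: mulr_ge0 (mulr_ge0 s0 K0) (nm_ge0 b).
move=> e e0; have e_n0 : e != 0 by rewrite gt_eqF.
have eC_n0 : e%:C != 0 by rewrite -(rmorph0 (real_complex R)) (inj_eq (@complexI _)).
have se : (1 + s / e)%:C *: b = (b + s%:C *: (p b + q b)) +
    (s / e)%:C *: (b - e%:C *: (p b + q b)).
  by lmod; rewrite ?rmorphD ?rmorphM ?fmorphV ?rmorph1; field.
have se0 : 0 <= s / e by rewrite divr_ge0 // ltW.
have := nmD (b + s%:C *: (p b + q b)) ((s / e)%:C *: (b - e%:C *: (p b + q b))).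
rewrite -se nmZr ?addr_ge0 // nmZr // => le1.
have := ler_wpM2l se0 (step e (ltW e0)).
have -> : s / e * ((1 + e ^+ 2 * K) * nm b) = s / e * nm b + e * (s * K * nm b).
  by field.
lra.
Qed.

(** Left multiplication by [k + c] in the unitization. *)
Definition shift k c : A -> A := fun b => k *: b + c ** b.

Lemma shift_is_linear k c : linear (shift k c).
Proof. by move=> l a b; rewrite /shift !csE; lmod; ring. Qed.

HB.instance Definition _ k c :=
  GRing.isLinear.Build R[i] A A _ (shift k c) (shift_is_linear k c).

Lemma shift_bounded k c : bounded (shift k c).
Proof.
exists (cabs k + nm c) => [|b]; first by rewrite addr_ge0 ?cabs_ge0 ?nm_ge0.
by rewrite (le_trans (nmD _ _)) // mulrDl nmZ lerD2l nmM.
Qed.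

Lemma shift_selfadj (r : R) c : c^# = c -> selfadj (shift r%:C c).
Proof. by move=> sc a b; rewrite /shift !csE sc conjc_real cs_mulA. Qed.

End Accretive.

(** * Quasi-inverses *)

Section QuasiInverse.
Variables (R : realType) (A : cstarAlgType R).
Implicit Types (a b c h y : A).

(** The Banach fixed point theorem for an affine contraction. *)
Lemma affine_fixpoint c w : nm c <= 2^-1 -> exists x : A, x = w + c ** x.
Proof.
move=> c_le; pose f x := w + c ** x; pose u n := iter n f 0.
have cf x y : nm (f x - f y) <= 2^-1 * nm (x - y).
  have -> : f x - f y = c ** (x - y) by rewrite /f !csE; lmod; ring.
  by rewrite (le_trans (nmM _ _)) // ler_wpM2r ?nm_ge0.
have half_ge0 n : 0 <= 2^-1 ^+ n :> R by rewrite exprn_ge0 ?invr_ge0.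
have u1 n : nm (u n.+1 - u n) <= 2^-1 ^+ n * nm w.
  elim: n => [|n IHn]; first by rewrite /u /= /f !csE addr0 subr0 expr0 mul1r.
  rewrite (le_trans (cf _ _)) // exprS -mulrA ler_wpM2l ?invr_ge0 //.
have um n m : nm (u (n + m)%N - u n) <= 2 * nm w * 2^-1 ^+ n.
  suff : nm (u (n + m)%N - u n) <= 2 * nm w * 2^-1 ^+ n * (1 - 2^-1 ^+ m).
    move=> /le_trans; apply; apply: ler_piMr; last by rewrite gerBl half_ge0.
    by rewrite mulr_ge0 ?half_ge0 // mulr_ge0 ?nm_ge0.
  elim: m => [|m IHm]; first by rewrite addn0 !subrr nm0 mulr0.
  rewrite addnS -(subrK (u (n + m)%N) (u (n + m).+1)) -addrA.
  rewrite (le_trans (nmD _ _)) //; have := u1 (n + m)%N.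
  by rewrite exprD exprS; lra.
have small (e : R) : 0 < e -> exists n, 2 * nm w * 2^-1 ^+ n < e.
  move=> e0; have w0 : 0 <= 2 * nm w / e by rewrite !mulr_ge0 ?nm_ge0 ?invr_ge0 ?ltW.
  exists (Num.Def.archi_bound (2 * nm w / e)).
  rewrite exprVn ltr_pdivrMr ?exprn_gt0 // [e * _]mulrC -ltr_pdivrMr //.
  by rewrite (lt_trans (archi_boundP w0)) // -natrX ltr_nat ltn_expl.
have u_cvg : cvg (u @ \oo)%classic.
  apply/cauchy_cvgP; apply: cauchy_exP => e e0.
  have e_r : e = (complex.Re e)%:C.
    by move: e0; rewrite ltcE /= => /andP[/eqP]; case: (e) => /= r i ->.
  have [|n n_small] := small (complex.Re e).
    by move: e0; rewrite ltcE /= => /andP[].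
  exists (u n), n => // m /= n_le.
  rewrite -ball_normE /= distrC norm_nm e_r ltcR -(subnKC n_le).
  by rewrite (le_lt_trans (um _ _)).
set l := (lim (u @ \oo))%classic.
have u_lim (e : R) : 0 < e -> exists n, nm (l - u n) < e /\ nm (l - u n.+1) < e.
  move=> e0.
  have /cvgrPdist_lt /(_ e%:C) : (u @ \oo --> l)%classic by exact: u_cvg.
  rewrite ltcR => /(_ e0) [n _ Hn]; exists n; split.
    by have := Hn n (leqnn n); rewrite /= norm_nm ltcR.
  by have := Hn n.+1 (leqnSn n); rewrite /= norm_nm ltcR.
exists l; apply/eqP; rewrite -subr_eq0; apply/eqP/nm_eq0/eqP.
rewrite eq_le nm_ge0 andbT; apply/ler_addgt0Pr => e e0; rewrite add0r.
have e20 : 0 < e / 2 by rewrite divr_gt0.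
have [n [h1 h2]] := u_lim (e / 2) e20.
have -> : l - (w + c ** l) = (l - u n.+1) + (f (u n) - f l).
  by rewrite -[w + c ** l]/(f l) -[u n.+1]/(f (u n)); lmod; ring.
have h3 := cf (u n) l.
have h4 := nmD (l - u n.+1) (f (u n) - f l).
have h5 : nm (u n - l) = nm (l - u n) by rewrite -opprB nmN.
lra.
Qed.

(** Continuation of the quasi-inverse along [t |-> t h]: as long as [1 + t h]
    is bounded below uniformly in [t], the set of invertible [1 + t h] is
    reached in finitely many steps of fixed length. *)
Lemma quasi_inverse h (C : R) :
  (forall (t : R) b, 0 <= t <= 1 -> nm b <= C * nm (b + t%:C *: (h ** b))) ->
  exists y, y + h + h ** y = 0 /\ y + h + y ** h = 0.
Proof.
move=> lowh.
have C0 b : 0 <= C * nm b.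
  have := lowh 0 b; rewrite scale0r addr0 lexx ler01 => /(_ erefl).
  exact: le_trans (nm_ge0 b).
pose good (t : R) := exists y, y + t%:C *: h + t%:C *: (h ** y) = 0.
have comm (t : R) y : 0 <= t <= 1 -> y + t%:C *: h + t%:C *: (h ** y) = 0 ->
    y + t%:C *: h + t%:C *: (y ** h) = 0.
  move=> t01 yE; set e := (X in X = 0).
  have e0 : e + t%:C *: (h ** e) = 0.
    transitivity ((y + t%:C *: h + t%:C *: (h ** y)) + t%:C *: ((y + t%:C *: h + t%:C *: (h ** y)) ** h)).
      by rewrite /e !csE ?cs_mulA; lmod; ring.
    by rewrite yE !csE scaler0 addr0.
  apply: nm_eq0; apply/eqP; rewrite eq_le nm_ge0 andbT.
  by have := lowh t e t01; rewrite e0 nm0 mulr0.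
have good0 : good 0.
  by exists 0; rewrite !scale0r !addr0.
pose n := Num.Def.archi_bound (2 * (C * nm h)).
have n_big : 2 * (C * nm h) < n.+1%:R.
  have Ch0 : 0 <= 2 * (C * nm h) by rewrite mulr_ge0 ?C0.
  by apply: (lt_le_trans (archi_boundP Ch0)); rewrite ler_nat.
have goodn m : (m <= n.+1)%N -> good (m%:R / n.+1%:R).
  elim: m => [|m IHm] m_le; first by rewrite mul0r.
  have [y yE] := IHm (ltnW m_le); set t := m%:R / _ in yE.
  have t01 : 0 <= t <= 1.
    by rewrite divr_ge0 //= ler_pdivrMr ?ltr0n // mul1r ler_nat ltnW.
  have yE' := comm t y t01 yE.
  pose d : R := n.+1%:R^-1.
  have d0 : 0 <= d by rewrite invr_ge0.
  have tS : m.+1%:R / n.+1%:R = t + d by rewrite /t /d -natr1 mulrDl mul1r.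
  have hy_le : nm (h + y ** h) <= C * nm h.
    rewrite (le_trans (lowh t _ t01)) // (_ : _ + _ = h) //.
    transitivity (h + (y + t%:C *: h + t%:C *: (h ** y)) ** h).
      by rewrite !csE ?cs_mulA; lmod; ring.
    by rewrite yE !csE addr0.
  (* With [1 + y] the inverse of [1 + t h], the inverse [1 + x] of
     [1 + (t + d) h] solves [1 + x = (1 + y) - d (1 + y) h (1 + x)]. *)
  have [|x xE] := @affine_fixpoint (- (d%:C *: (h + y ** h))) (y - d%:C *: (h + y ** h)).
    rewrite nmN nmZr // mulrC ler_pdivrMr ?ltr0n //.
    by rewrite (le_trans hy_le) // -ler_pdivrMl ?invr_gt0 // invrK ltW.
  exists x; rewrite tS.
  have E1 : x + (t + d)%:C *: h + (t + d)%:C *: (h ** x) = 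
    (x - (y - d%:C *: (h + y ** h) + (- (d%:C *: (h + y ** h))) ** x)) +
    t%:C *: (h ** (x - (y - d%:C *: (h + y ** h) + (- (d%:C *: (h + y ** h))) ** x)))
    + (y + t%:C *: h + t%:C *: (h ** y)) - 
    d%:C *: ((y + t%:C *: h + t%:C *: (h ** y)) ** (h + h ** x)).
    by rewrite !csE ?cs_mulA; lmod; rewrite ?rmorphD; ring.
  by rewrite E1 yE -xE subrr !csE !scaler0 ?addr0 ?subr0.
have := goodn n.+1 (leqnn _); rewrite divff ?pnatr_eq0 // => -[y].
rewrite scale1r scale1r => yE; exists y; split => //.
by have := comm 1 y; rewrite !scale1r ler01 lexx; apply.
Qed.
End QuasiInverse.

(** * Positivity of [c^* c] *)

Section Positivity.
Variables (R : realType) (A : cstarAlgType R).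
Implicit Types (a b c d h k : A).

(** For selfadjoint [k], [k + x + i y] is bounded below by [|y|]. *)
Lemma imaginary_lower k (x y : R) b : k^# = k ->
  `|y| * nm b <= nm (shift (x%:C + 'i * y%:C) k b).
Proof.
move=> sk; pose X := x%:C *: b + k ** b; pose Y := y%:C *: b.
have XY : X^# ** Y = Y^# ** X.
  by rewrite /X /Y !csE ?conjc_real sk ?cs_mulA; lmod; ring.
have [_ YS] := nm_sum_squares XY.
rewrite -(@ler_pXn2r _ 2) ?nnegrE ?mulr_ge0 ?nm_ge0 //.
have := YS; rewrite {1}/Y nmZ cabs_real => /le_trans; apply.
have ii : 'i * 'i = -1 :> R[i] by rewrite -expr2 sqr_i.
rewrite -nmC le_eqVlt; apply/orP; left; apply/eqP; congr (cs_norm _).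
have zJ : conjc (x%:C + 'i * y%:C) = x%:C - 'i * y%:C.
  by apply/eqP; rewrite eq_complex /=; apply/andP; split; apply/eqP; ring.
by rewrite /shift /X /Y !csE zJ ?conjc_real ?sk ?cs_mulA; lmod; ring: ii.

Qed.

Lemma shift_can (z w : R[i]) k g : w * z = 1 ->
  z *: g + w *: k + k ** g = 0 -> cancel (shift w g) (shift z k).
Proof.
move=> wz E b; transitivity (b + (z *: g + w *: k + k ** g) ** b).
  by rewrite /shift !csE ?cs_mulA; lmod; ring: wz.
by rewrite E !csE addr0.
Qed.

(** The inverse of [k + z] in the unitization, written [w + g], and its
    adjoint. *)
Lemma resolvent k (x y : R) (z := x%:C + 'i * y%:C) : k^# = k -> y != 0 ->
  exists w g, [/\ cancel (shift w g) (shift z k), cancel (shift z k) (shift w g)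
    & cancel (shift (conjc z) k) (shift (conjc w) g^#)
      /\ cancel (shift (conjc w) g^#) (shift (conjc z) k)].
Proof.
move=> sk y_n0.
have z_n0 : z != 0.
  by rewrite eq_complex /= !(mul0r, mul1r, add0r, subr0, mulr0, addr0) (negPf y_n0) andbF.
have yp : 0 < `|y| by rewrite normr_gt0.
have [|u [E1 E2]] := @quasi_inverse _ A (z^-1 *: k) (cabs z / `|y|).
  move=> t b /andP[t0 t1]; have stk : (t%:C *: k)^# = t%:C *: k by rewrite csE conjc_real sk.
  rewrite mulrAC ler_pdivlMr // mulrC (le_trans (imaginary_lower x y b stk)) //.
  rewrite -nmZ le_eqVlt; apply/orP; left; apply/eqP; congr (cs_norm _).
  by rewrite /shift -/z !csE; lmod; field.
pose w := z^-1; pose g := w *: u.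
have g1 : z *: g + w *: k + k ** g = 0.
  by rewrite -[RHS]E1 /g /w !csE; lmod; field.
have g2 : z *: g + w *: k + g ** k = 0.
  by rewrite -[RHS]E2 /g /w !csE; lmod; field.
have wz : w * z = 1 by rewrite mulVf.
have wzJ : conjc w * conjc z = 1 by rewrite -rmorphM wz rmorph1.
have g1J : conjc z *: g^# + conjc w *: k + g^# ** k = 0.
  by rewrite -[RHS](cs_star0 A) -g1 !csE sk.
have g2J : conjc z *: g^# + conjc w *: k + k ** g^# = 0.
  by rewrite -[RHS](cs_star0 A) -g2 !csE sk.
exists w, g; split; [| |split].
- exact: shift_can.
- by apply: shift_can; rewrite ?[w *: k + _]addrC // mulrC.
- by apply: shift_can; rewrite ?[_ *: k + _]addrC // mulrC.
- exact: shift_can.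
Qed.

(** Apart from [0], [d^* d] and [d d^*] have the same approximate
    eigenvalues. *)
Lemma bounded_below_swap d (l : R) : 0 < l ->
  bounded_below (fun b => l%:C *: b - (d^# ** d) ** b) ->
  bounded_below (fun b => l%:C *: b - (d ** d^#) ** b).
Proof.
move=> l0 [C C0 low]; exists ((1 + nm d * (C * nm d)) / l) => [|b].
  by rewrite divr_ge0 ?(ltW l0) // addr_ge0 // !mulr_ge0 ?nm_ge0.
set e := _ - _.
have db_le : nm (d^# ** b) <= C * (nm d * nm e).
  apply: (le_trans (low _)); rewrite ler_wpM2l //.
  rewrite -[nm d]nm_star (le_trans _ (nmM _ _)) // le_eqVlt; apply/orP; left.
  by apply/eqP; congr (cs_norm _); rewrite /e !csE ?cs_mulA.
rewrite mulrAC ler_pdivlMr // [nm b * l]mulrC -(nmZr b (ltW l0)).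
have -> : l%:C *: b = e + d ** (d^# ** b) by rewrite /e cs_mulA subrK.
rewrite (le_trans (nmD _ _)) // mulrDl mul1r lerD2l (le_trans (nmM _ _)) //.
by rewrite -!mulrA ler_wpM2l ?nm_ge0.
Qed.

Lemma shift_real_lower (l : R) k b : (l - nm k) * nm b <= nm (shift l%:C k b).
Proof.
have := nm_sub (l%:C *: b) (k ** b); have := nmM k b.
rewrite nmZ cabs_real /shift; have := ler_norm l; have := nm_ge0 b => b0 ll.
by have := ler_wpM2r b0 ll; lra.
Qed.

Lemma bounded_belowW (p : A -> A) (e : R) : 0 < e ->
  (forall b, e * nm b <= nm (p b)) -> bounded_below p.
Proof.
move=> e0 low; exists e^-1 => [|b]; first by rewrite invr_ge0 ltW.
by rewrite mulrC ler_pdivlMr // mulrC.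
Qed.

(** An upper bound [B] for the approximate eigenvalues of a selfadjoint
    element is an upper bound in the sense of accretivity. *)
Lemma accretive_of_bounded_below h (B : R) : h^# = h -> 0 <= B ->
  (forall l, B < l -> bounded_below (fun b => l%:C *: b - h ** b)) ->
  accretive (shift B%:C (- h)).
Proof.
move=> sh B0 low; pose s := nm h.
have s0 : 0 <= s by exact: nm_ge0.
have sB : 0 <= s + B by rewrite addr_ge0.
have le b : nm (shift s%:C h b) <= (s + B) * nm b.
  apply: selfadj_norm_le => //; first exact: shift_selfadj.
  - exact: shift_bounded.
  - move=> l ltl; have [|C C0 HC] := low (l - s); first by rewrite ltrBrDl.
    exists C => // {}b; rewrite (le_trans (HC b)) // ler_wpM2l //.
    rewrite le_eqVlt; apply/orP; left; apply/eqP; congr (cs_norm _).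
    by rewrite /= /shift; lmod; ring.
  - move=> l ltl; apply: (@bounded_belowW _ l) => [|{}b].
      exact: le_lt_trans ltl.
    have := shift_real_lower (l + s) h b; rewrite addrK => /le_trans; apply.
    rewrite le_eqVlt; apply/orP; left; apply/eqP; congr (cs_norm _).
    by rewrite /= /shift; lmod; ring.
move=> t b t0.
have E : b + t%:C *: shift B%:C (- h) b =
    (1 + t * (B + s))%:C *: b - t%:C *: shift s%:C h b.
  by rewrite /shift !csE; lmod; ring.
have := nm_sub ((1 + t * (B + s))%:C *: b) (- (t%:C *: shift s%:C h b)).
rewrite -E nmN !nmZr ?addr_ge0 ?mulr_ge0 ?addr_ge0 //.
by have := ler_wpM2l t0 (le b); lra.
Qed.

End Positivity.

Section StarSquares.
Variables (R : realType) (A : cstarAlgType R).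
Implicit Types (a b c d h k : A).

(** Positivity of an element, expressed by its left multiplication. *)
Definition cs_accretive h := accretive (fun b => h ** b).

Lemma cs_accretiveE h : cs_accretive h <-> accretive (shift 0 h).
Proof.
by split=> acc t b t0; have := acc t b t0; rewrite /shift scale0r add0r.
Qed.

Lemma cs_accretiveD h k : cs_accretive h -> cs_accretive k -> cs_accretive (h + k).
Proof.
move=> /cs_accretiveE acc_h /cs_accretiveE acc_k t b t0.
have := accretiveD acc_h acc_k (shift_bounded _ _) (shift_bounded _ _) b t0.
by rewrite /= /shift !scale0r !add0r cs_mulDl.
Qed.

Lemma cs_accretive_sqr h : h^# = h -> cs_accretive (h ** h).
Proof.
move=> sh t b t0; have := selfadj_sqr_accretive b (shift_selfadj 0 sh) t0.
by rewrite /= /shift !scale0r !add0r cs_mulA.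
Qed.

(** [d^* d + d d^*] is twice the sum of the squares of the real and imaginary
    parts of [d]. *)
Lemma cs_accretive_swap d : cs_accretive (d^# ** d + d ** d^#).
Proof.
have ii : 'i * 'i = -1 :> R[i] by rewrite -expr2 sqr_i.
have iJ : conjc 'i = - 'i :> R[i] by apply/eqP; rewrite eq_complex /= oppr0 !eqxx.
pose r := (2^-1)%:C *: (d + d^#); pose s := ('i * (2^-1)%:C) *: (d^# - d).
have sr : r^# = r by rewrite /r !csE conjc_real addrC.
have ss : s^# = s.
  have sJ : conjc ('i * (2^-1)%:C) = - ('i * (2^-1)%:C) :> R[i].
    by rewrite -mulNr -iJ -[in RHS](conjc_real (2^-1)) -rmorphM.
  by rewrite /s !csE sJ; lmod; ring.
have -> : d^# ** d + d ** d^# = (r ** r + s ** s) + (r ** r + s ** s).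
  by rewrite /r /s !csE; lmod; rewrite ?fmorphV ?rmorph_nat; field: ii.
by have acc := cs_accretiveD (cs_accretive_sqr sr) (cs_accretive_sqr ss);
  exact: cs_accretiveD.
Qed.

(** An upper bound for [d^* d] is one for [d d^*], and
    [d^* d + d d^*] is accretive, so that [- B] is a lower bound for
    [d^* d]. *)
Lemma star_sqr_norm_le d (B : R) : 0 <= B ->
  (forall l, B < l -> bounded_below (fun b => l%:C *: b - (d^# ** d) ** b)) ->
  forall b, nm ((d^# ** d) ** b) <= B * nm b.
Proof.
move=> B0 low b.
have acc1 : accretive (shift B%:C (- (d ** d^#))).
  apply: accretive_of_bounded_below => //; first by rewrite !csE.
  by move=> l ltl; apply: bounded_below_swap (low l ltl); exact: le_lt_trans ltl.
have acc2 := proj1 (cs_accretiveE _) (cs_accretive_swap d).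
have acc := accretiveD acc1 acc2 (shift_bounded _ _) (shift_bounded _ _).
have -> : (d^# ** d) ** b = shift 0 (d^# ** d) b by rewrite /shift scale0r add0r.
apply: selfadj_norm_le => //.
- by apply: (shift_selfadj 0); rewrite !csE.
- exact: shift_bounded.
- move=> l ltl; have [C C0 HC] := low l ltl; exists C => // {}b.
  by rewrite /= /shift scale0r add0r.
- move=> l ltl; apply: (@bounded_belowW _ _ _ (l - B)); first by rewrite subr_gt0.
  move=> {}b; have lB : 0 < l - B by rewrite subr_gt0.
  rewrite -ler_pdivlMl // -nmZr ?invr_ge0 ?(ltW lB) //.
  apply: (le_trans (acc (l - B)^-1 b _)); first by rewrite invr_ge0 ltW.
  have lBC : l%:C - B%:C != 0.
    by rewrite -rmorphB -(rmorph0 (real_complex R)) (inj_eq (@complexI _)) gt_eqF.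
  rewrite le_eqVlt; apply/orP; left; apply/eqP; congr (cs_norm _).
  by rewrite /= /shift !csE; lmod; rewrite ?fmorphV ?rmorphB; field.
Qed.

Section Resolvent.
Variables (c : A) (nu eta : R).
Hypotheses (nu0 : 0 < nu) (eta_n0 : eta != 0).
Let k := c^# ** c.
Let z := nu%:C + 'i * eta%:C.

(** With [f = (c^* c + z)^-1] and [d = c f], the element
    [d^* d = c^* c |f|^2] is at most [1 / (4 nu)], because
    [x / ((x + nu)^2 + eta^2) <= 1 / (4 nu)] on the real line. This gives a
    bound for [f] that does not depend on [eta]. *)
Lemma resolvent_bound b : nm b <= 2 / nu * nm (shift z k b).
Proof.
have sk : k^# = k by rewrite /k !csE.
have [w [g [F1 F2 [G1 G2]]]] := resolvent nu sk eta_n0.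
rewrite -/z in F1 F2 G1 G2.
pose F := shift w g; pose G := shift (conjc w) g^#.
pose d := w *: c + c ** g.
have zJ : conjc z = nu%:C - 'i * eta%:C.
  by apply/eqP; rewrite eq_complex /=; apply/andP; split; apply/eqP; ring.
have ii : 'i * 'i = -1 :> R[i] by rewrite -expr2 sqr_i.
have FG a x : (F a)^# ** x = a^# ** G x by rewrite /F /G /shift !csE !cs_mulA.
have ddE x : (d^# ** d) ** x = G (k ** F x).
  by rewrite /d /G /F /k /shift !csE !cs_mulA; lmod; ring.
pose B := (4 * nu)^-1.
have B0 : 0 < B by rewrite invr_gt0 mulr_gt0.
have dd_le : forall x, nm ((d^# ** d) ** x) <= B * nm x.
  apply: star_sqr_norm_le (ltW B0) _ => l ltl.
  have l0 : 0 < l by exact: lt_trans ltl.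
  have l_n0 : l%:C != 0.
    by rewrite -(rmorph0 (real_complex R)) (inj_eq (@complexI _)) gt_eqF.
  (* On the real line,
     [l ((x + nu)^2 + eta^2) - x = l ((x + m)^2 + gam)] with [gam > 0]. *)
  pose m := nu - (2 * l)^-1; pose gam := nu ^+ 2 + eta ^+ 2 - m ^+ 2.
  have gam0 : 0 < gam.
    have -> : gam = eta ^+ 2 + (4 * nu * l - 1) / (4 * l ^+ 2).
      by rewrite /gam /m; field; rewrite gt_eqF.
    rewrite ltr_wpDl ?sqr_ge0 // divr_gt0 ?mulr_gt0 ?exprn_gt0 //.
    by rewrite subr_gt0 -ltr_pdivrMl ?mulr1 // mulr_gt0.
  have [C1 C10 HC1] := shift_bounded z k.
  have [C2 C20 HC2] := shift_bounded (conjc z) k.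
  exists (C1 * C2 / (l * gam)) => [|x].
    by rewrite divr_ge0 ?mulr_ge0 // ?(ltW l0) ?(ltW gam0).
  pose x' := G (F x).
  have xE : x = shift z k (shift (conjc z) k x') by rewrite /x' /G G2 F1.
  have dx : (d^# ** d) ** x = k ** x'.
    rewrite ddE -{1}[F x]G2 -/x' -[RHS]G1; congr G.
    by rewrite /shift /x' !csE.
  have -> : l%:C *: x - (d^# ** d) ** x = l%:C *: (gam%:C *:
      (x' + (gam^-1)%:C *: shift m%:C k (shift m%:C k x'))).
    have hm : m%:C = nu%:C - (2 * l%:C)^-1.
      by rewrite /m rmorphB fmorphV rmorphM rmorph_nat.
    have hg : gam%:C = nu%:C ^+ 2 + eta%:C ^+ 2 - m%:C ^+ 2.
      by rewrite /gam rmorphB rmorphD !rmorphXn.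
    have hgV : gam%:C * (gam^-1)%:C = 1 by rewrite -rmorphM divff ?gt_eqF.
    rewrite scalerDr [gam%:C *: ((gam^-1)%:C *: _)]scalerA hgV scale1r.
    rewrite dx xE /shift zJ /z !csE ?cs_mulA hg hm.
    by lmod; field: ii.
  rewrite !nmZr ?(ltW l0) ?(ltW gam0) //.
  have x'_le : nm x' <= nm (x' + (gam^-1)%:C *: shift m%:C k (shift m%:C k x')).
    by apply: selfadj_sqr_accretive; [exact: shift_selfadj|rewrite invr_ge0 ltW].
  set N := nm (x' + _) in x'_le *.
  have -> : C1 * C2 / (l * gam) * (l * (gam * N)) = C1 * (C2 * N).
    by field; rewrite !gt_eqF.
  rewrite xE (le_trans (HC1 _)) // ler_wpM2l // (le_trans (HC2 _)) //.
  by rewrite ler_wpM2l.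
(* [z |b|^2] is controlled by pairing [(c^* c + z) b] with [b]. *)
have zb : z *: (b^# ** b) =
    b^# ** shift z k b - (shift z k b)^# ** ((d^# ** d) ** shift z k b).
  rewrite ddE -FG /F F2 /shift !csE; lmod; ring.
have nu_z : nu <= cabs z.
  apply: le_trans (Re_le_cabs z); rewrite /= mul0r mul1r subr0 addr0.
  exact: ler_norm.
have h1 := nmB (b^# ** shift z k b) ((shift z k b)^# ** ((d^# ** d) ** shift z k b)).
rewrite -zb nmZ nmC in h1.
have h2 := nmM b^# (shift z k b); rewrite nm_star in h2.
have h3 := nmM (shift z k b)^# ((d^# ** d) ** shift z k b); rewrite nm_star in h3.
have h4 := ler_wpM2l (nm_ge0 (shift z k b)) (dd_le (shift z k b)).
have h5 := ler_wpM2r (sqr_ge0 (nm b)) nu_z.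
move: (nm_ge0 b) (nm_ge0 (shift z k b)) h1 h2 h3 h4 h5.
move: (nm b) (nm (shift z k b)) => x y x0 y0 h1 h2 h3 h4 h5.
rewrite mulrAC ler_pdivlMr // leNgt; apply/negP => lt_yx.
have h6 : nu * x ^+ 2 <= x * y + B * y ^+ 2 by lra.
have h7 : (x * nu) ^+ 2 <= (x * nu) * y + y ^+ 2 / 4.
  have -> : (x * nu) ^+ 2 = nu * (nu * x ^+ 2) by ring.
  have -> : x * nu * y + y ^+ 2 / 4 = nu * (x * y + B * y ^+ 2).
    by rewrite /B; field; rewrite gt_eqF.
  by rewrite ler_pM2l.
have Xy : 0 < x * nu + y by lra.
have X2y : 0 < x * nu - 2 * y by rewrite subr_gt0.
have := mulr_gt0 X2y Xy; have := sqr_ge0 y.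
by move: (x * nu) h7 => X h7; lra.
Qed.
End Resolvent.

(** A product [c^* c] is positive: letting [eta] tend to [0] in
    [resolvent_bound], [nu + c^* c] is bounded below for all [nu > 0]. *)
Theorem star_sqr_accretive c : cs_accretive (c^# ** c).
Proof.
apply/cs_accretiveE.
have acc : accretive (shift (0 : R)%:C (- - (c^# ** c))).
  apply: accretive_of_bounded_below => //; first by rewrite !csE.
  move=> nu nu0; exists (2 / nu) => [|b]; first by rewrite divr_ge0 // ltW.
  have nn0 : 0 <= 2 / nu by rewrite divr_ge0 // ltW.
  apply: (@le_mul_eps _ _ _ (2 / nu * nm b)); first by rewrite mulr_ge0 ?nm_ge0.
  move=> e e0; have e_n0 : e != 0 by rewrite gt_eqF.
  have := resolvent_bound c nu0 e_n0 b.
  set X := shift _ _ _; set Y := _ - _.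
  have XE : X = Y + ('i * e%:C) *: b by rewrite /X /Y /shift !csE; lmod; ring.
  have := nmD Y (('i * e%:C) *: b); rewrite -XE nmZ cabsM cabsi mul1r cabs_real gtr0_norm //.
  by move=> /(ler_wpM2l nn0); lra.
by move: acc; rewrite opprK.
Qed.
End StarSquares.

(** * Cauchy-Schwarz and triangle inequality in inner product modules *)

Section Module.
Variables (R : realType) (A : cstarAlgType R).

(** The norm is monotone on positive elements. *)
Lemma nm_accretive_le (h q : A) : h^# = h -> cs_accretive h ->
  cs_accretive (q - h) -> nm h <= nm q.
Proof.
move=> sh acc_h acc_qh.
have le b : nm (h ** b) <= nm q * nm b.
  have -> : h ** b = shift 0 h b by rewrite /shift scale0r add0r.
  apply: selfadj_norm_le; [exact: (shift_selfadj 0 sh)|exact: shift_bounded|exact: nm_ge0| |].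
  - move=> l ltl; have l0 : 0 < l by apply: le_lt_trans ltl; exact: nm_ge0.
    apply: (@bounded_belowW _ _ _ (l - nm q)) => [|{}b]; first by rewrite subr_gt0.
    have l0C : l%:C != 0 by rewrite -(rmorph0 (real_complex R)) (inj_eq (@complexI _)) gt_eqF.
    have lV : 0 <= l^-1 by rewrite invr_ge0 ltW.
    have := ler_wpM2l (ltW l0) (acc_qh l^-1 b lV).
    rewrite -(nmZr _ (ltW l0)) -[l * nm (_ + _)](nmZr _ (ltW l0)).
    have -> : l%:C *: (b + (l^-1)%:C *: ((q - h) ** b)) =
        (l%:C *: b - shift 0 h b) + q ** b.
      by rewrite /shift !csE; lmod; rewrite ?fmorphV; field.
    have := nmD (l%:C *: b - shift 0 h b) (q ** b); have := nmM q b.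
    by rewrite nmZr ?(ltW l0) //= ; lra.
  - move=> l ltl; have l0 : 0 < l by apply: le_lt_trans ltl; exact: nm_ge0.
    apply: (@bounded_belowW _ _ _ l) => // {}b.
    have l0C : l%:C != 0 by rewrite -(rmorph0 (real_complex R)) (inj_eq (@complexI _)) gt_eqF.
    have lV : 0 <= l^-1 by rewrite invr_ge0 ltW.
    have := ler_wpM2l (ltW l0) (acc_h l^-1 b lV) => /le_trans; apply.
    rewrite -(nmZr _ (ltW l0)) le_eqVlt; apply/orP; left; apply/eqP; congr (cs_norm _).
    by rewrite /= /shift; lmod; rewrite ?fmorphV; field.
have [->|nz] := eqVneq (nm h) 0; first exact: nm_ge0.
have h0 : 0 < nm h by rewrite lt0r nz nm_ge0.
by rewrite -(ler_pM2r h0) -expr2 -nmC sh le.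
Qed.

Variable V : innerModType A.
Implicit Types (x y z : V) (a b : A) (k : R[i]).
Local Notation N := im_norm.

Lemma im_innerDl x y z : im_inner (x + y) z = im_inner x z + im_inner y z.
Proof. by rewrite -im_inner_star im_innerDr cs_starD !im_inner_star. Qed.

Lemma im_innerZl k x y : im_inner (k *: x) y = conjc k *: im_inner x y.
Proof. by rewrite -im_inner_star im_innerZr cs_starZ im_inner_star. Qed.

Lemma im_innerAl x a y : im_inner (im_act x a) y = a^# ** im_inner x y.
Proof. by rewrite -im_inner_star im_innerAr cs_starM im_inner_star. Qed.

Lemma im_innerNl x y : im_inner (- x) y = - im_inner x y.
Proof. by rewrite -scaleN1r im_innerZl rmorphN rmorph1 scaleN1r. Qed.

Lemma im_innerNr x y : im_inner x (- y) = - im_inner x y.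
Proof. by rewrite -scaleN1r im_innerZr scaleN1r. Qed.

Definition imE := (im_innerDl, @im_innerDr _ A V, im_innerZl, @im_innerZr _ A V,
  im_innerAl, @im_innerAr _ A V, im_innerNl, im_innerNr).

Lemma im_norm_ge0 x : 0 <= N x. Proof. exact: sqrtr_ge0. Qed.

Lemma im_norm_sqr x : N x ^+ 2 = nm (im_inner x x).
Proof. by rewrite sqr_sqrtr ?nm_ge0. Qed.

Lemma im_norm_eq0 x : N x = 0 -> x = 0.
Proof.
move=> Nx; apply/im_inner_eq0/nm_eq0; by rewrite -im_norm_sqr Nx expr0n.
Qed.

Lemma im_normZ k x : N (k *: x) = cabs k * N x.
Proof.
apply/eqP; rewrite -(@eqrXn2 _ 2) ?mulr_ge0 ?cabs_ge0 ?im_norm_ge0 //.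
by rewrite exprMn !im_norm_sqr !imE !nmZ cabsJ mulrA -expr2.
Qed.

(** With [e^* e = <x, x>] and [p = (<x, x> + eta)^-1 <x, y>], the element
    [<y, y>] is the sum of [<y - x p, y - x p>], [(e p)^* (e p)] and
    [2 eta p^* p]. *)
Lemma im_inner_cauchy_schwarz x y : nm (im_inner x y) <= N x * N y.
Proof.
apply: (@le_mul_eps _ _ _ (N y)) => [|s s0]; first exact: im_norm_ge0.
have [e eE] := im_inner_pos x; set k := im_inner x x in eE.
set g := im_inner x y; set q := im_inner y y.
pose eta := s ^+ 2; have eta0 : 0 < eta by rewrite exprn_gt0.
have etaC : eta%:C != 0 by rewrite -(rmorph0 (real_complex R)) (inj_eq (@complexI _)) gt_eqF.
have acc_k : cs_accretive k by rewrite eE; exact: star_sqr_accretive.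
have [|u [u1 _]] := @quasi_inverse _ A ((eta^-1)%:C *: k) 1.
  move=> t b /andP[t0 _]; rewrite mul1r csE scalerA -rmorphM.
  by apply: acc_k; rewrite mulr_ge0 // invr_ge0 ltW.
have [p pg] : exists p, k ** p + eta%:C *: p = g.
  exists ((eta^-1)%:C *: (g + u ** g)).
  rewrite -[RHS]addr0 -(cs_mul0r g) -u1 !csE ?cs_mulA.
  by lmod; rewrite ?fmorphV; field.
have sk : k^# = k by rewrite /k im_inner_star.
have gp : g^# = p^# ** k + eta%:C *: p^#.
  by rewrite -pg !csE conjc_real sk.
pose r : A := (Num.sqrt (2 * eta))%:C *: p.
have rE : r^# ** r = (2 * eta)%:C *: (p^# ** p).
  rewrite /r !csE conjc_real scalerA -rmorphM -expr2 sqr_sqrtr //.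
  by apply: mulr_ge0; [exact: ler0n|exact: ltW].
have qE : q = im_inner (y - im_act x p) (y - im_act x p) +
    ((e ** p)^# ** (e ** p) + r^# ** r).
  rewrite rE !imE -/q -/g -/k -(im_inner_star x y) -/g gp -{1}pg.
  have -> : (e ** p)^# ** (e ** p) = p^# ** k ** p by rewrite !csE eE !cs_mulA.
  by rewrite !csE ?cs_mulA; lmod; rewrite ?rmorphM ?rmorph_nat; ring.
have [f fE] := im_inner_pos (y - im_act x p).
have acc c : cs_accretive (c^# ** c) by exact: star_sqr_accretive.
have Ny : nm q = N y ^+ 2 by rewrite im_norm_sqr.
have ep_le : nm (e ** p) <= N y.
  rewrite -(@ler_pXn2r _ 2) ?nnegrE ?nm_ge0 ?im_norm_ge0 // -Ny -nmC.
  apply: nm_accretive_le; [by rewrite !csE|exact: acc|].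
  set E := _ ** (e ** p) in qE *.
  have -> : q - E = f^# ** f + r^# ** r by rewrite qE fE; lmod; ring.
  by apply: cs_accretiveD; exact: acc.
have p_le : s * nm p <= N y.
  rewrite -(@ler_pXn2r _ 2) ?nnegrE ?mulr_ge0 ?nm_ge0 ?im_norm_ge0 ?(ltW s0) // -Ny.
  have r_le : nm (r^# ** r) <= nm q.
    apply: nm_accretive_le; [by rewrite !csE|exact: acc|].
    set E := _ ** (e ** p) in qE *.
    have -> : q - r^# ** r = f^# ** f + E by rewrite qE fE; lmod; ring.
    by apply: cs_accretiveD; exact: acc.
  move: r_le; rewrite rE. rewrite nmZr; last by apply: mulr_ge0; [exact: ler0n|exact: ltW].
  rewrite nmC /eta exprMn.
  have := mulr_ge0 (sqr_ge0 s) (sqr_ge0 (nm p)); lra.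
have Nx : nm e = N x.
  by apply/eqP; rewrite -(@eqrXn2 _ 2) ?nm_ge0 ?im_norm_ge0 // -nmC -eE im_norm_sqr.
have -> : g = e^# ** (e ** p) + eta%:C *: p by rewrite cs_mulA -eE pg.
rewrite (le_trans (nmD _ _)) // nmZr ?(ltW eta0) // lerD //.
  rewrite (le_trans (nmM _ _)) // nm_star Nx ler_wpM2l ?im_norm_ge0 //.
by rewrite /eta expr2 -mulrA ler_wpM2l // ltW.
Qed.

Lemma im_normD x y : N (x + y) <= N x + N y.
Proof.
rewrite -(@ler_pXn2r _ 2) ?nnegrE ?addr_ge0 ?im_norm_ge0 //.
have := nmD (im_inner x x + im_inner x y) (im_inner y x + im_inner y y).
have := nmD (im_inner x x) (im_inner x y); have := nmD (im_inner y x) (im_inner y y).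
have := im_inner_cauchy_schwarz x y; have := im_inner_cauchy_schwarz y x.
rewrite im_norm_sqr !imE -!im_norm_sqr [im_inner x x + _ + _]addrACA; lra.
Qed.

Lemma im_normN x : N (- x) = N x.
Proof. by rewrite -scaleN1r im_normZ cabsN cabs1 mul1r. Qed.

Lemma im_normB x y : N (x - y) <= N x + N y.
Proof. by rewrite -(im_normN y) im_normD. Qed.

Lemma im_norm0 : N (0 : V) = 0.
Proof. by rewrite -(scale0r (0 : V)) im_normZ cabs0 mul0r. Qed.

(** * From approximate strong orthogonality to approximate orthogonality *)

(** Approximate units: [a = - y] where [y] is the quasi-inverse of [- i t h],
    [h = <v, v>]. Then [2 y^* y = - (y + y^* )], so that [|y| <= 1], and
    [h (1 + y) = y / (i t)] is small. *)
Lemma approximate_unit (v : V) (t : R) : 0 < t ->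
  exists a, nm a <= 1 /\ N (v - im_act v a) ^+ 2 <= 2 / t.
Proof.
move=> t0; pose h := im_inner v v; have sh : h^# = h by rewrite /h im_inner_star.
have ii : 'i * 'i = -1 :> R[i] by rewrite -expr2 sqr_i.
have iJ : conjc 'i = - 'i :> R[i] by apply/eqP; rewrite eq_complex /= oppr0 !eqxx.
have [|y [yE _]] := @quasi_inverse _ A (- ('i * t%:C) *: h) 1.
  move=> r b _; rewrite mul1r.
  have srh : ((r * t)%:C *: h)^# = (r * t)%:C *: h by rewrite csE conjc_real sh.
  have := imaginary_lower 0 1 b srh; rewrite normr1 mul1r => /le_trans; apply.
  have nmi (x : A) : nm x = nm ('i *: x) by rewrite nmZ cabsi mul1r.
  rewrite [nm (b + _)]nmi le_eqVlt; apply/orP; left; apply/eqP; congr (cs_norm _).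
  by rewrite /shift !csE; lmod; rewrite ?rmorphM ?rmorph0 ?rmorph1; ring: ii.
have yJ : y^# + ('i * t%:C) *: h + ('i * t%:C) *: (y^# ** h) = 0.
  have tJ : conjc (- ('i * t%:C)) = 'i * t%:C :> R[i].
    by apply/eqP; rewrite eq_complex /=; apply/andP; split; apply/eqP; ring.
  by rewrite -[RHS](cs_star0 A) -yE !csE tJ sh.
set E := (X in X = 0) in yE; set E' := (X in X = 0) in yJ.
have y2 : 2%:C *: (y^# ** y) = - (y + y^#).
  transitivity (y^# ** E + E' ** y + E + E' - (y + y^#)).
    by rewrite /E /E' !csE ?cs_mulA; lmod; rewrite ?rmorph_nat; ring.
  by rewrite yE yJ !csE !addr0 add0r.
have y_le1 : nm y <= 1.
  have := nmD y y^#; rewrite -[nm (y + _)]nmN -y2 nmZr // nmC nm_star.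
  have [->|nz] := eqVneq (nm y) 0; first by rewrite ler01.
  have y0 : 0 < nm y by rewrite lt0r nz nm_ge0.
  by move=> le2; rewrite -(ler_pM2r y0) mul1r -expr2; lra.
exists (- y); split; first by rewrite nmN.
have -> : im_act v (- y) = - im_act v y by rewrite -scaleN1r im_actZr scaleN1r.
rewrite opprK im_norm_sqr ler_pdivlMr // mulrC -(nmZr _ (ltW t0)).
rewrite -[nm _]mul1r -{1}(cabsi R) -nmZ.
have -> : 'i *: (t%:C *: im_inner (v + im_act v y) (v + im_act v y)) =
    y + y^# ** y.
  transitivity (y + y^# ** y - (E + y^# ** E)); last by rewrite yE !csE addr0 subr0.
  by rewrite !imE -/h /E !csE ?cs_mulA; lmod; ring.
have := nmD y (y^# ** y); have := nmM y^# y; rewrite nm_star.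
have := ler_wpM2l (nm_ge0 y) y_le1; lra.
Qed.

(** Apply the hypothesis to [a = k a'] with [a'] an approximate unit for [v]. *)
Lemma approx_bj_of_strong (eps : R) (u v : V) (k : R[i]) : 0 <= eps ->
  approx_strong_bj_orth eps u v ->
  N u ^+ 2 - 2 * eps * cabs k * N u * N v <= N (u + k *: v) ^+ 2.
Proof.
move=> eps0 orth; set L := _ - _.
have [L0|L0] := leP L 0; first by rewrite (le_trans L0) ?sqr_ge0.
rewrite -(sqr_sqrtr (ltW L0)) ler_pXn2r ?nnegrE ?sqrtr_ge0 ?im_norm_ge0 //.
apply: (@le_mul_eps _ _ _ (cabs k)) => [|s s0]; first exact: cabs_ge0.
have [|a [a1 av]] := @approximate_unit v (2 / s ^+ 2).
  by rewrite divr_gt0 ?exprn_gt0.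
have va_le : N (v - im_act v a) <= s.
  rewrite -(@ler_pXn2r _ 2) ?nnegrE ?im_norm_ge0 ?(ltW s0) //.
  by move: av; rewrite invf_div mulrC divfK.
have L_le : L <= N (u + im_act v (k *: a)) ^+ 2.
  apply: le_trans (orth _); rewrite /L lerD2l lerN2.
  rewrite -[cs_norm _]/(nm _) nmZ ler_wpM2r ?im_norm_ge0 //.
  rewrite ler_wpM2r ?im_norm_ge0 // ler_wpM2l ?mulr_ge0 //.
  by rewrite ler_piMr ?cabs_ge0.
apply: (@le_trans _ _ (N (u + im_act v (k *: a)))).
  by rewrite -(@ler_pXn2r _ 2) ?nnegrE ?sqrtr_ge0 ?im_norm_ge0 // sqr_sqrtr // ltW.
have -> : u + im_act v (k *: a) = (u + k *: v) + (- k) *: (v - im_act v a).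
  by rewrite im_actZr; lmod; ring.
rewrite (le_trans (im_normD _ _)) // lerD2l im_normZ cabsN mulrC.
by rewrite ler_wpM2r ?cabs_ge0.
Qed.
End Module.

(** * Support functionals *)

Section HahnBanach.
Variables (R : realType) (A : cstarAlgType R) (V : innerModType A).
Implicit Types (x y z v w : V) (k : R[i]).
Local Notation N := im_norm.

(** One-step extension of a dominated real functional, given by its graph
    [G]. *)
Lemma hahn_banach_step (G : V -> R -> Prop) w :
  G 0 0 -> (forall v v' r r', G v r -> G v' r' -> G (v + v') (r + r')) ->
  (forall v r (t : R), 0 < t -> G v r -> G (t%:C *: v) (t * r)) ->
  (forall v r, G v r -> r <= N v) ->
  exists a, forall v r (t : R), G v r -> r + t * a <= N (v + t%:C *: w).
Proof.
move=> G0 GD GZ GN.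
pose S : set R := [set s | exists v r, G v r /\ s = r - N (v - w)]%classic.
have sep v v' r r' : G v r -> G v' r' -> r - N (v - w) <= N (v' + w) - r'.
  move=> Gv Gv'; have := GN _ _ (GD _ _ _ _ Gv Gv').
  have -> : v + v' = (v - w) + (v' + w) by lmod; ring.
  have := im_normD (v - w) (v' + w); lra.
have hasS : has_sup S.
  split; first by exists (0 - N (0 - w)); exists 0, 0.
  by exists (N (0 + w) - 0) => _ [v [r [Gv ->]]]; apply: sep.
pose a := sup S; exists a => v r t Gv.
have aG v' r' : G v' r' -> r' - N (v' - w) <= a.
  by move=> Gv'; apply: (sup_upper_bound hasS); exists v', r'.
have Ga v' r' : G v' r' -> a <= N (v' + w) - r'.
  move=> Gv'; apply: sup_le_ub; first by case: hasS.
  by move=> _ [v'' [r'' [Gv'' ->]]]; apply: sep.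
have scale (s : R) (u : V) : 0 < s -> N u = s * N ((s^-1)%:C *: u).
  move=> s0; rewrite im_normZ cabs_real gtr0_norm ?invr_gt0 //.
  by rewrite mulrA divff ?mul1r // gt_eqF.
have CV (s : R) : s != 0 -> (s^-1)%:C * s%:C = 1 by move=> s0; rewrite -rmorphM mulVf.
have [t0|t0|->] := ltrgt0P t; last by rewrite mul0r scale0r !addr0 GN.
- have tV : 0 < t^-1 by rewrite invr_gt0.
  have := Ga _ _ (GZ _ _ _ tV Gv); rewrite (scale t (v + t%:C *: w)) // scalerDr scalerA CV ?gt_eqF //.
  rewrite scale1r => le_a; have := ler_wpM2l (ltW t0) le_a.
  by rewrite mulrBr mulrA divff ?gt_eqF // mul1r; lra.
- have s0 : 0 < - t by rewrite oppr_gt0.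
  have sV : 0 < (- t)^-1 by rewrite invr_gt0.
  have := aG _ _ (GZ _ _ _ sV Gv); rewrite (scale (- t) (v + t%:C *: w)) // scalerDr scalerA.
  have -> : ((- t)^-1)%:C * t%:C = -1.
    by rewrite -rmorphM invrN mulNr mulVf ?lt_eqF // rmorphN rmorph1.
  rewrite scaleN1r.
  move=> le_a; have := ler_wpM2l (ltW s0) le_a.
  by rewrite mulrBr mulrA divff ?gt_eqF // mul1r; lra.
Qed.

(** A norming functional at [z], restricted to the span of [z] and [w], is
    given by the scalar [mu] such that [w - mu z] is in its kernel. *)
Lemma norming_scalar z w : 0 < N z ->
  exists mu : R[i], forall k, cabs (mu - k) * N z <= N (w - k *: z).
Proof.
move=> z0; set n := N z.
(* Extend [k z |-> |z| Re k] to the directions [w], then [i w]. *)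
pose G0 v r := exists k, v = k *: z /\ r = n * complex.Re k.
have [|v v' r r' [k [-> ->]] [k' [-> ->]]|v r t t0 [k [-> ->]]|v r [k [-> ->]]|a aG] :=
  @hahn_banach_step G0 w.
- by exists 0; rewrite scale0r mulr0.
- exists (k + k'); rewrite scalerDl; split => //.
  by case: k k' => [? ?] [? ?] /=; ring.
- exists (t%:C * k); rewrite scalerA; split => //.
  by case: k => [? ?] /=; ring.
- by rewrite im_normZ mulrC ler_wpM2r ?im_norm_ge0 // (le_trans (ler_norm _)) ?Re_le_cabs.
pose G1 v r := exists k (t : R), v = k *: z + t%:C *: w /\ r = n * complex.Re k + t * a.
have [|v v' r r' [k [t [-> ->]]] [k' [t' [-> ->]]]|v r s s0 [k [t [-> ->]]]|v r [k [t [-> ->]]]|b bG] :=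
  @hahn_banach_step G1 ('i *: w).
- by exists 0, 0; rewrite !scale0r mulr0 mul0r !addr0.
- exists (k + k'), (t + t'); split; first by lmod; rewrite ?rmorphD; ring.
  by case: k k' => [? ?] [? ?] /=; ring.
- exists (s%:C * k), (s * t); split; first by lmod; rewrite ?rmorphM; ring.
  by case: k => [? ?] /=; ring.
- by apply: aG; exists k.
(* A real functional [g] is the real part of [v |-> g v - i g (i v)]. *)
pose mu : R[i] := (a / n) -i* (b / n); exists mu => k.
have [->|mu_k] := eqVneq mu k; first by rewrite subrr cabs0 mul0r im_norm_ge0.
(* The scalar [e] rotates [w - k z] so that the functional is real there. *)
pose e := conjc (mu - k).
have e0 : 0 < cabs e by rewrite cabsJ cabs_gt0 subr_eq0.
have -> : cabs (mu - k) = cabs e by rewrite cabsJ.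
rewrite -(ler_pM2l e0) -(im_normZ e (w - k *: z)) mulrA -expr2.
pose v := (- (e * k)) *: z + (complex.Re e)%:C *: w.
have Gv : G1 v (n * complex.Re (- (e * k)) + complex.Re e * a).
  by exists (- (e * k)), (complex.Re e).
have := bG _ _ (complex.Im e) Gv.
have -> : v + (complex.Im e)%:C *: ('i *: w) = e *: (w - k *: z).
  have eE : e = (complex.Re e)%:C + 'i * (complex.Im e)%:C by rewrite {1}[e]complexE.
  by rewrite /v; move: eE; move: (complex.Re e)%:C (complex.Im e)%:C => p q ->; lmod; ring.
move/(le_trans _); apply; rewrite le_eqVlt; apply/orP; left; apply/eqP.
rewrite cabs_sqr /e /mu; case: k {mu_k e e0 v Gv} => p q /=.
by field; rewrite gt_eqF.
Qed.

(** Right existence of Birkhoff-James orthogonality. *)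
Lemma exists_bj_orth z w : 0 < N z ->
  exists mu : R[i], bj_orth z (w - mu *: z) /\ cabs mu * N z <= N w.
Proof.
move=> z0; have [mu muP] := norming_scalar w z0; exists mu; split; last first.
  by have := muP 0; rewrite subr0 scale0r subr0.
move=> k; have [->|k0] := eqVneq k 0; first by rewrite scale0r addr0.
have := muP (mu - k^-1); rewrite opprB addrC subrK cabsV.
have -> : z + k *: (w - mu *: z) = k *: (w - (mu - k^-1) *: z).
  by lmod; field.
by rewrite im_normZ -ler_pdivlMl ?invr_gt0 ?cabs_gt0 // invrK.
Qed.
End HahnBanach.

(** * Variation of the quotient [|T z| / |z|] along a segment *)

Section Path.
Variables (R : realType) (A : cstarAlgType R) (V W : innerModType A).
Variables (eps : R) (T : {linear V -> W}).
Hypothesis eps0 : 0 <= eps.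
Hypothesis T_orth : forall (u v : V) (k : R[i]), bj_orth u v ->
  im_norm (T u) ^+ 2 - 2 * eps * cabs k * im_norm (T u) * im_norm (T v)
    <= im_norm (T u + k *: T v) ^+ 2.
Implicit Types (x y z u v : V) (k : R[i]).
Local Notation N := im_norm.

Let TD u v : T (u + v) = T u + T v. Proof. exact: linearD. Qed.
Let TZ k u : T (k *: u) = k *: T u. Proof. exact: linearZ. Qed.

(** The square root of the hypothesis, in the weaker form
    [sqrt (a^2 - a b) >= a - b] for [a >= b >= 0]. *)
Lemma orth_preserver_linear_lower u v k : bj_orth u v ->
  N (T u) - 2 * eps * cabs k * N (T v) <= N (T u + k *: T v).
Proof.
move=> orth; have := T_orth k orth; set a := N (T u); set b := 2 * eps * cabs k * N (T v).
have a0 : 0 <= a by exact: im_norm_ge0.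
have b0 : 0 <= b by rewrite !mulr_ge0 ?cabs_ge0 ?im_norm_ge0.
have -> : 2 * eps * cabs k * a * N (T v) = a * b by rewrite /b; ring.
move=> le; have [ab|ab] := leP (a - b) 0; first by rewrite (le_trans ab) ?im_norm_ge0.
rewrite -(@ler_pXn2r _ 2) ?nnegrE ?im_norm_ge0 ?(ltW ab) // (le_trans _ le) //.
have := mulr_ge0 b0 (ltW ab); lra.
Qed.

(** With [d = |x - y| <= |x + y|], the norm is at least [1 - t d] and at least
    [(1 - t) d - (1 - 2 t)], for [t <= 1/2]; the combination with weights
    [1 - t] and [t] is [1 - 2 t + 2 t^2 >= 1/2]. *)
Lemma segment_norm_ge x y (t : R) : N x = 1 -> N y = 1 -> N (x - y) <= N (x + y) ->
  0 <= t <= 1 -> 2^-1 <= N (x + t%:C *: (y - x)).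
Proof.
move=> Nx Ny le.
wlog t_le : x y t Nx Ny le / t <= 2^-1.
  move=> Hw t01; have [|t_gt] := leP t 2^-1; first by move/Hw; apply.
  have -> : x + t%:C *: (y - x) = y + (1 - t)%:C *: (x - y).
    by lmod; rewrite ?rmorphB ?rmorph1; ring.
  apply: Hw => //; [|by lra|by lra].
  by rewrite -(im_normN (y - x)) opprB [y + x]addrC.
move=> /andP[t0 t1]; set z := _ + _.
have h1 : 1 <= N z + t * N (x - y).
  have := im_normD z (t%:C *: (x - y)); rewrite im_normZ cabs_real ger0_norm //.
  by rewrite (_ : _ + _ *: _ = x) ?Nx // /z; lmod; ring.
have h2 : (1 - t) * N (x + y) <= N z + (1 - 2 * t).
  have t1' : 0 <= 1 - t by rewrite subr_ge0.
  have t2' : 0 <= 1 - 2 * t by lra.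
  have := im_normD z ((1 - 2 * t)%:C *: y); rewrite im_normZ cabs_real ger0_norm // Ny mulr1.
  have -> : z + (1 - 2 * t)%:C *: y = (1 - t)%:C *: (x + y).
    by rewrite /z; lmod; rewrite ?rmorphB ?rmorphM ?rmorph1 ?rmorph_nat; ring.
  by rewrite im_normZ cabs_real ger0_norm.
have t1' : 0 <= 1 - t by rewrite subr_ge0.
have := ler_wpM2l t1' h1; have := ler_wpM2l t0 h2.
have := ler_wpM2l t0 (ler_wpM2l t1' le); have := sqr_ge0 (t - 2^-1); lra.
Qed.

(** Comparison of two points of the segment at distance [h], in terms of the
    norming scalars [m] at [u] and [m'] at [u + h w]. The numbers
    [1 + h Re m] and [1 - h Re m'] are, up to second order, the quotients of
    the norms, so that they telescope along the segment. *)
Lemma segment_step u w (h M : R) (m m' : R[i]) :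
  0 < h -> h < 4^-1 -> 0 <= M ->
  bj_orth u (w - m *: u) -> bj_orth (u + h%:C *: w) (w - m' *: (u + h%:C *: w)) ->
  cabs m <= 4 -> cabs m' <= 4 -> 2^-1 <= N u -> 2^-1 <= N (u + h%:C *: w) ->
  N (T (w - m' *: (u + h%:C *: w))) <= 4 * M ->
  N (T (u + h%:C *: w)) <= M * N (u + h%:C *: w) ->
  N (T (u + h%:C *: w)) / (N (u + h%:C *: w) * (1 + h * complex.Re m')) -
    h * (16 * h * M + 16 * eps * M) / (1 - 4 * h)
  <= N (T u) / (N u * (1 + h * complex.Re m)).
Proof.
set u' := u + _ => h0 h4 M0 orth orth' m4 m'4 Nu Nu' Tv'_le Tu'_le.
have r4 := le_trans (Re_le_cabs m) m4; have r'4 := le_trans (Re_le_cabs m') m'4.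
move: r4 r'4; rewrite !ler_norml => /andP[r_ge r_le] /andP[r'_ge r'_le].
set r := complex.Re m in r_ge r_le *; set r' := complex.Re m' in r'_ge r'_le *.
have Re_p k : 0 < complex.Re k -> k != 0.
  by case: k => a b /= a0; rewrite eq_complex /= gt_eqF.
have hr : h * r <= 4 * h /\ - (4 * h) <= h * r.
  by have := ler_wpM2l (ltW h0) r_le; have := ler_wpM2l (ltW h0) r_ge; lra.
have hr' : h * r' <= 4 * h /\ - (4 * h) <= h * r'.
  by have := ler_wpM2l (ltW h0) r'_le; have := ler_wpM2l (ltW h0) r'_ge; lra.
have Re1 : complex.Re (1 + h%:C * m) = 1 + h * r.
  by rewrite /r; case: (m) => a b /=; ring.
have Re2 : complex.Re (1 - h%:C * m') = 1 - h * r'.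
  by rewrite /r'; case: (m') => a b /=; ring.
have nz1 : 1 + h%:C * m != 0 by apply: Re_p; rewrite Re1; lra.
have nz2 : 1 - h%:C * m' != 0 by apply: Re_p; rewrite Re2; lra.
have low1 : N u * (1 + h * r) <= N u'.
  have -> : u' = (1 + h%:C * m) *: (u + (h%:C / (1 + h%:C * m)) *: (w - m *: u)).
    by rewrite /u'; lmod; field.
  rewrite im_normZ mulrC; apply: ler_pM; rewrite ?im_norm_ge0 //; first by lra.
  by rewrite -Re1 (le_trans (ler_norm _)) ?Re_le_cabs.
set v' := w - m' *: u' in orth' Tv'_le.
have low2 : (1 - h * r') * N (T u') - 8 * eps * h * M <= N (T u).
  have uE : u = (1 - h%:C * m') *: (u' + (- h%:C / (1 - h%:C * m')) *: v').
    by rewrite /v' /u'; lmod; field.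
  have := orth_preserver_linear_lower (- h%:C / (1 - h%:C * m')) orth'.
  rewrite uE TZ TD TZ im_normZ => le.
  have c0 := cabs_ge0 (1 - h%:C * m').
  have := ler_wpM2l c0 le; apply: le_trans.
  rewrite mulrBr lerB //.
    by rewrite ler_wpM2r ?im_norm_ge0 // -Re2 (le_trans (ler_norm _)) ?Re_le_cabs.
  rewrite cabsM cabsV cabsN cabs_real gtr0_norm //.
  have cp : cabs (1 - h%:C * m') != 0 by rewrite cabs_eq0.
  set c := cabs (1 - h%:C * m') in cp *.
  have -> : c * (2 * eps * (h / c) * N (T v')) = 2 * eps * h * N (T v') by field.
  have e20 : 0 <= 2 * eps * h by rewrite !mulr_ge0 ?(ltW h0).
  have := ler_wpM2l e20 Tv'_le; lra.
set D := N u * (1 + h * r); set D' := N u' * (1 + h * r').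
have D0 : 0 < D by rewrite mulr_gt0; lra.
have D'0 : 0 < D' by rewrite mulr_gt0; lra.
have h41 : 0 < 1 - 4 * h by lra.
have D_ge : (1 - 4 * h) / 2 <= D.
  by rewrite mulrC; apply: ler_pM; rewrite ?(ltW h41) //; lra.
have D'_ge : (1 - 4 * h) * N u' <= D'.
  by rewrite mulrC ler_wpM2l ?im_norm_ge0 //; lra.
have s_le : N (T u') / D' <= M / (1 - 4 * h).
  rewrite ler_pdivrMr // [M / _ * _]mulrAC ler_pdivlMr //.
  have := ler_wpM2l M0 D'_ge; have := ler_wpM2r (ltW h41) Tu'_le; lra.
have e_le : 8 * eps * h * M / D <= h * (16 * eps * M) / (1 - 4 * h).
  have K0 : 0 <= 8 * eps * h * M by rewrite !mulr_ge0 // ltW.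
  rewrite ler_pdivrMr // [h * _ / _ * _]mulrAC ler_pdivlMr //.
  have := ler_wpM2l K0 D_ge; lra.
have main : (1 - h ^+ 2 * r' ^+ 2) * (N (T u') / D') <= (1 - h * r') * N (T u') / D.
  have -> : (1 - h ^+ 2 * r' ^+ 2) * (N (T u') / D') = (1 - h * r') * N (T u') / N u'.
    by rewrite /D'; field; rewrite !gt_eqF //; lra.
  apply: ler_wpM2l; first by rewrite mulr_ge0 ?im_norm_ge0 //; lra.
  by rewrite lef_pV2 ?posrE //; lra.
have low2' : (1 - h * r') * N (T u') / D - 8 * eps * h * M / D <= N (T u) / D.
  by rewrite -mulrBl ler_wpM2r // invr_ge0 ltW.
have rr : h ^+ 2 * r' ^+ 2 * (N (T u') / D') <= 16 * h ^+ 2 * (M / (1 - 4 * h)).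
  apply: ler_pM s_le; first by rewrite mulr_ge0 ?sqr_ge0.
    by rewrite divr_ge0 ?im_norm_ge0 // ltW.
  have -> : 16 * h ^+ 2 = h ^+ 2 * 4 ^+ 2 by ring.
  by rewrite ler_wpM2l ?sqr_ge0 // -[r' ^+ 2]real_normK ?num_real // ler_pXn2r ?nnegrE // ler_norml r'_ge.
have -> : h * (16 * h * M + 16 * eps * M) / (1 - 4 * h) =
    16 * h ^+ 2 * (M / (1 - 4 * h)) + h * (16 * eps * M) / (1 - 4 * h).
  by field; rewrite gt_eqF.
lra.
Qed.

(** The quotient [|T z| / |z|] varies by at most [16 eps M] along a segment of
    length at most [2] that stays at distance at least [1/2] from [0]. *)
Lemma segment_lower x y (M : R) : N x = 1 -> N y = 1 -> N (x - y) <= N (x + y) ->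
  0 <= M ->
  (forall a b : R[i], N (T (a *: x + b *: y)) <= M * N (a *: x + b *: y)) ->
  N (T y) - 16 * eps * M <= N (T x).
Proof.
move=> Nx Ny le M0 TM; pose w := y - x; pose z (t : R) := x + t%:C *: w.
have w2 : N w <= 2 by rewrite (le_trans (im_normB _ _)) // Nx Ny.
have zz (t h : R) : z (t + h) = z t + h%:C *: w.
  by rewrite /z; lmod; rewrite ?rmorphD; ring.
have z_ge (t : R) : 0 <= t <= 1 -> 2^-1 <= N (z t) by exact: segment_norm_ge.
have z_span (t : R) (k : R[i]) : exists a b : R[i], w - k *: z t = a *: x + b *: y.
  exists (- 1 - k * (1 - t%:C)), (1 - k * t%:C).
  by rewrite /z /w; lmod; ring.
have Tz_le (t : R) : N (T (z t)) <= M * N (z t).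
  have -> : z t = (1 - t%:C) *: x + t%:C *: y by rewrite /z /w; lmod; ring.
  exact: TM.
have mex (t : R) : exists m : R[i], 0 <= t <= 1 ->
    [/\ bj_orth (z t) (w - m *: z t), cabs m <= 4 & N (T (w - m *: z t)) <= 4 * M].
  have [t01|] := boolP (0 <= t <= 1); last by exists 0.
  have Nz := z_ge t t01; have Nz0 : 0 < N (z t) by lra.
  have [m [orth m_le]] := exists_bj_orth w Nz0; exists m => _; split => //.
    by have := ler_wpM2l (cabs_ge0 m) Nz; lra.
  have [a [b ab]] := z_span t m; rewrite ab (le_trans (TM _ _)) // -ab.
  have := im_normB w (m *: z t); rewrite im_normZ => le1.
  by rewrite mulrC ler_wpM2r //; lra.
have [m mP] := choice mex.
(* Dividing by [1 + h Re m] makes the estimates of consecutive steps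
   telescope. *)
pose sig (h t : R) := N (T (z t)) / (N (z t) * (1 + h * complex.Re (m t))).
have main (n : nat) : (4 < n)%N -> N (T y) - 16 * eps * M - 24 * n%:R^-1 * M <= N (T x).
  move=> n4; pose h : R := n%:R^-1.
  have n0 : 0 < n%:R :> R by rewrite ltr0n (leq_trans _ n4).
  have h0 : 0 < h by rewrite invr_gt0.
  have h4 : h < 4^-1 by rewrite ltf_pV2 ?posrE // ltr_nat.
  have h41 : 0 < 1 - 4 * h by lra.
  pose c := (16 * h * M + 16 * eps * M) / (1 - 4 * h).
  have ih01 i : (i <= n)%N -> 0 <= i%:R * h <= 1.
    move=> i_le; rewrite mulr_ge0 ?ler0n ?(ltW h0) //=.
    by rewrite ler_pdivrMr // mul1r ler_nat.
  have sumstep i : (i <= n)%N -> sig h (i%:R * h) - i%:R * h * c <= sig h 0.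
    elim: i => [|i IHi] i_le; first by rewrite !mul0r subr0.
    have iS : i.+1%:R * h = i%:R * h + h by rewrite -natr1 mulrDl mul1r.
    have [ ort1 m1 _] := mP _ (ih01 i (ltnW i_le)).
    have [ ort2 m2 v2] := mP _ (ih01 i.+1 i_le).
    have Nz1 := z_ge _ (ih01 i (ltnW i_le)); have Nz2 := z_ge _ (ih01 i.+1 i_le).
    have Tz2 := Tz_le (i.+1%:R * h).
    have zS : z (i.+1%:R * h) = z (i%:R * h) + h%:C *: w by rewrite iS zz.
    move: ort2 v2 Nz2 Tz2; rewrite zS => ort2 v2 Nz2 Tz2.
    have := segment_step h0 h4 M0 ort1 ort2 m1 m2 Nz1 Nz2 v2 Tz2.
    rewrite -zS -/(sig h (i.+1%:R * h)) -/(sig h (i%:R * h)) -mulrA -/c.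
    by have := IHi (ltnW i_le); rewrite iS; lra.
  have := sumstep n (leqnn n); rewrite divff ?gt_eqF // mul1r.
  have z0 : z 0 = x by rewrite /z scale0r addr0.
  have z1 : z 1 = y by rewrite /z /w scale1r addrCA subrr addr0.
  rewrite /sig z0 z1 Nx Ny !mul1r.
  have [|_ m0 _] := mP 0; first by rewrite lexx ler01.
  have [|_ m1 _] := mP 1; first by rewrite lexx ler01.
  have := le_trans (Re_le_cabs _) m0; have := le_trans (Re_le_cabs _) m1.
  rewrite !ler_norml; move: (complex.Re (m 0)) (complex.Re (m 1)) => r0 r1.
  move=> /andP[r1_ge r1_le] /andP[r0_ge r0_le].
  have hr0 := ler_wpM2l (ltW h0) r0_ge; have hr1 := ler_wpM2l (ltW h0) r1_le.
  have hr1' := ler_wpM2l (ltW h0) r1_ge.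
  have Ty_le : N (T y) <= M by have := TM 0 1; rewrite scale0r scale1r add0r Ny mulr1.
  have Tx0 := im_norm_ge0 (T x); have Ty0 := im_norm_ge0 (T y).
  have a0 : 0 < 1 + h * r0 by lra.
  have a1 : 0 < 1 + h * r1 by lra.
  have le0 : N (T x) / (1 + h * r0) <= N (T x) / (1 - 4 * h).
    by rewrite ler_wpM2l // lef_pV2 ?posrE //; lra.
  have le1 : (1 - 4 * h) * N (T y) <= N (T y) / (1 + h * r1).
    rewrite ler_pdivlMr // mulrAC ler_piMl //.
    have := ler_wpM2l (ltW h41) (_ : 1 + h * r1 <= 1 + 4 * h); have := sqr_ge0 h.
    by move=> ? /(_ ltac:(lra)); lra.
  move=> le2; have := le_trans (lerB le1 (lexx c)) (le_trans le2 le0).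
  rewrite ler_pdivlMr // mulrBl /c divfK ?gt_eqF // -/h.
  have := ler_wpM2l (ltW h0) Ty_le; have := mulr_ge0 (sqr_ge0 h) Ty0; lra.
apply: (@le_mul_eps _ _ _ (24 * M)) => [|e e0]; first by rewrite mulr_ge0.
pose n := (Num.Def.archi_bound e^-1 + 5)%N.
have ne : n%:R^-1 <= e.
  rewrite -[e]invrK lef_pV2 ?posrE ?invr_gt0 ?ltr0n ?addnS //.
  rewrite (le_trans (ltW (archi_boundP _))) ?invr_ge0 ?(ltW e0) // ler_nat.
  exact: leq_addr.
have n4 : (4 < n)%N by rewrite /n addnS ltnS leq_addl.
have := main n n4; have := ler_wpM2r M0 ne.
by move: (n%:R^-1) => h; lra.
Qed.

(** The norm [M] of [T] on the span of [x] and [y] is finite because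
    this span is generated by [x] and a vector [v] to which [x] is orthogonal;
    [segment_lower] is applied to [x] or [- x] and an almost maximal unit
    vector of that span. *)
Lemma orth_preserver_norm_ge x y : N x = 1 -> N y = 1 -> (1 - 16 * eps) * N (T y) <= N (T x).
Proof.
move=> Nx Ny; have Nx0 : 0 < N x by rewrite Nx.
have [mu [orth _]] := exists_bj_orth y Nx0; set v := y - mu *: x in orth.
have [e16|e16] := leP (1 - 16 * eps) 0.
  by rewrite (le_trans _ (im_norm_ge0 _)) // mulr_le0_ge0 ?im_norm_ge0.
have [v0|v_n0] := eqVneq (N v) 0.
  have yE : y = mu *: x by apply/eqP; rewrite -subr_eq0; apply/eqP/im_norm_eq0.
  have mu1 : cabs mu = 1 by rewrite -Ny yE im_normZ Nx mulr1.
  rewrite yE TZ im_normZ mu1 mul1r ler_piMl ?im_norm_ge0 //.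
  by rewrite gerBl mulr_ge0.
have v_gt0 : 0 < N v by rewrite lt0r v_n0 im_norm_ge0.
pose span u := exists a b : R[i], u = a *: x + b *: y.
pose S : set R := [set s | exists u, [/\ span u, N u <= 1 & s = N (T u)]]%classic.
have Sy : S (N (T y)).
  by exists y; split; rewrite ?Ny //; exists 0, 1; rewrite scale0r scale1r add0r.
have hasS : has_sup S.
  split; first by exists (N (T y)).
  exists (N (T x) + 2 / N v * N (T v)) => _ [u [[a [b uE]] u1 ->]].
  have {}uE : u = (a + b * mu) *: x + b *: v by rewrite uE /v; lmod; ring.
  have a_le : cabs (a + b * mu) <= N u.
    have [->|nz] := eqVneq (a + b * mu) 0; first by rewrite cabs0 im_norm_ge0.
    have := ler_wpM2l (cabs_ge0 (a + b * mu)) (orth (b / (a + b * mu))).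
    rewrite -im_normZ -im_normZ scalerDr scalerA mulrCA divff // mulr1 -uE.
    by rewrite im_normZ Nx mulr1.
  have b_le : cabs b * N v <= 2.
    have := im_normB u ((a + b * mu) *: x); rewrite im_normZ Nx mulr1.
    by rewrite {1}uE addrAC subrr add0r im_normZ; lra.
  rewrite uE TD !TZ (le_trans (im_normD _ _)) // !im_normZ lerD //.
    by rewrite ler_piMl ?im_norm_ge0 // (le_trans a_le).
  by rewrite ler_wpM2r ?im_norm_ge0 // ler_pdivlMr.
pose M := sup S.
have S_le s : S s -> s <= M by exact: sup_upper_bound.
have Ty_le : N (T y) <= M by exact: S_le.
have M0 : 0 <= M by exact: le_trans (im_norm_ge0 _) Ty_le.
have unitE u : 0 < N u -> u = (N u)%:C *: ((N u)^-1%:C *: u).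
  by move=> u0; rewrite scalerA -rmorphM divff ?gt_eqF // scale1r.
have unitN u : 0 < N u -> N ((N u)^-1%:C *: u) = 1.
  by move=> u0; rewrite im_normZ cabs_real gtr0_norm ?invr_gt0 // mulVf ?gt_eqF.
have span_unit u (r : R) : span u -> span (r%:C *: u).
  by case=> a [b ->]; exists (r%:C * a), (r%:C * b); lmod; ring.
have TM u : span u -> N (T u) <= M * N u.
  move=> su; have [u0|u_n0] := eqVneq (N u) 0.
    by rewrite (im_norm_eq0 u0) linear0 !im_norm0 mulr0.
  have u0 : 0 < N u by rewrite lt0r u_n0 im_norm_ge0.
  rewrite {1}(unitE u u0) TZ im_normZ cabs_real gtr0_norm // mulrC ler_wpM2r ?im_norm_ge0 //.
  by apply: S_le; exists ((N u)^-1%:C *: u); split; [exact: span_unit|rewrite unitN|].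
have near_max s : 0 < s -> s < M -> M - s - 16 * eps * M <= N (T x).
  move=> s0 sM; have [_ [u [su u1 ->]] Tu] := sup_adherent s0 hasS.
  have u0 : 0 < N u.
    rewrite lt0r im_norm_ge0 andbT; apply/eqP => u0; have := TM u su.
    by rewrite u0 mulr0 => Tu0; move: Tu; rewrite -/M; lra.
  pose y' := (N u)^-1%:C *: u; have Ny' : N y' = 1 by exact: unitN.
  have Ty' : M - s <= N (T y').
    rewrite (le_trans (ltW Tu)) // {1}(unitE u u0) TZ im_normZ cabs_real gtr0_norm //.
    by rewrite ler_piMl ?im_norm_ge0.
  have [a [b y'E]] := span_unit u (N u)^-1 su.
  have [le|ge] := leP (N (x - y')) (N (x + y')).
    have TM' c d : N (T (c *: x + d *: y')) <= M * N (c *: x + d *: y').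
      by apply: TM; exists (c + d * a), (d * b); rewrite /y' y'E; lmod; ring.
    have := segment_lower Nx Ny' le M0 TM'; lra.
  have Nx' : N (- x) = 1 by rewrite im_normN.
  have le : N (- x - y') <= N (- x + y').
    have -> : - x + y' = - (x - y') by rewrite opprB addrC.
    by rewrite -opprD !im_normN ltW.
  have TM' c d : N (T (c *: - x + d *: y')) <= M * N (c *: - x + d *: y').
    by apply: TM; exists (- c + d * a), (d * b); rewrite /y' y'E; lmod; ring.
  have := segment_lower Nx' Ny' le M0 TM'.
  by rewrite linearN im_normN; lra.
apply: (@le_trans _ _ ((1 - 16 * eps) * M)); first by rewrite ler_wpM2l ?(ltW e16).
have [M_le|M_gt0] := leP M 0.
  by rewrite (le_trans _ (im_norm_ge0 _)) // mulr_ge0_le0 ?(ltW e16).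
apply/ler_addgt0Pr => e e0; pose s := Num.min e (M / 2).
have s0 : 0 < s by rewrite lt_min e0 divr_gt0.
have sM : s < M by rewrite gt_min; apply/orP; right; lra.
have se : s <= e by rewrite ge_min lexx.
have := near_max s s0 sM; lra.
Qed.
End Path.

(** * Norm estimate for orthogonality preserving maps *)

Theorem corollary3p3 (R : realType) (A : cstarAlgType R)
    (V W : innerModType A) (eps : R) (T : {linear V -> W})
    (eps_ge0 : 0 <= eps) (eps_lt : eps < 1 / 2)
    (T_orth : forall x y : V,
       bj_orth x y -> approx_strong_bj_orth eps (T x) (T y)) :
  forall x : V,
    ((1 - 16 * eps)%:E * op_norm T * (im_norm x)%:E <= (im_norm (T x))%:E)%E /\
    ((im_norm (T x))%:E <= op_norm T * (im_norm x)%:E)%E.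
Proof.
have T_orth' (u v : V) (k : R[i]) : bj_orth u v ->
    im_norm (T u) ^+ 2 - 2 * eps * cabs k * im_norm (T u) * im_norm (T v)
      <= im_norm (T u + k *: T v) ^+ 2.
  by move=> /T_orth; exact: approx_bj_of_strong.
have TZ (k : R[i]) (u : V) : T (k *: u) = k *: T u by exact: linearZ.
have T0 : im_norm (T 0) = 0 by rewrite linear0 im_norm0.
have op_ge0 : (0 <= op_norm T)%E.
  by apply: ereal_sup_ubound; exists 0; rewrite /= ?im_norm0 ?T0.
have unitN (u : V) : 0 < im_norm u -> im_norm ((im_norm u)^-1%:C *: u) = 1.
  by move=> u0; rewrite im_normZ cabs_real gtr0_norm ?invr_gt0 // mulVf ?gt_eqF.
move=> x; have [x0|x_n0] := eqVneq (im_norm x) 0.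
  by rewrite (im_norm_eq0 x0) T0 im_norm0 !mule0.
have x_gt0 : 0 < im_norm x by rewrite lt0r x_n0 im_norm_ge0.
have TxE : im_norm (T x) = im_norm (T ((im_norm x)^-1%:C *: x)) * im_norm x.
  rewrite TZ im_normZ cabs_real gtr0_norm ?invr_gt0 //.
  by rewrite mulrAC mulVf // mul1r.
split; last first.
  rewrite TxE EFinM lee_wpmul2r ?lee_fin ?im_norm_ge0 //.
  by apply: ereal_sup_ubound; exists ((im_norm x)^-1%:C *: x); rewrite /= ?unitN.
rewrite TxE EFinM lee_wpmul2r ?lee_fin ?im_norm_ge0 //.
have [e16|e16] := leP (1 - 16 * eps) 0.
  apply: (@le_trans _ _ 0%E); last by rewrite lee_fin im_norm_ge0.
  by rewrite mule_le0_ge0 // lee_fin.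
rewrite muleC -lee_pdivlMr // -EFinM.
apply: ub_ereal_sup => _ [y /= y1 <-]; rewrite lee_fin ler_pdivlMr // mulrC.
have [y0|y_n0] := eqVneq (im_norm y) 0.
  by rewrite (im_norm_eq0 y0) T0 mulr0 im_norm_ge0.
have y_gt0 : 0 < im_norm y by rewrite lt0r y_n0 im_norm_ge0.
apply: le_trans (orth_preserver_norm_ge eps_ge0 T_orth' (unitN x x_gt0) (unitN y y_gt0)).
rewrite ler_wpM2l ?(ltW e16) // TZ im_normZ cabs_real gtr0_norm ?invr_gt0 //.
by rewrite ler_peMl ?im_norm_ge0 // invf_ge1.
Qed.
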